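(* For each integer $n\ge1$ let $\mathrm{E}_{\min}(n)$ denote the minimum of $|\mathcal{E}(P)|$ over all $n$-dimensional monotone polytopes $P\subset\mathbb{R}^n$. Then, for integers $k\ge 0$, $$\mathrm{E}_{\min}(n)\le\begin{cases}3\cdot9^k,&\text{if }n=3k+1,\\ \frac{59}{9}\cdot9^k,&\text{if }n=3k+2\text{ and }k\ne0\ (\text{i.e. } n\neq 2),\\ 13\cdot9^k,&\text{if }n=3k+3.\end{cases}$$ Hence $$\lim_{n\to\infty}\sqrt[n]{\mathrm{E}_{\min}(n)}\le\sqrt[3]{9}\approx2.08.$$
   Context: The Ewald set of a polytope $P\subset\mathbb{R}^n$ is $\mathcal{E}(P):=\mathbb{Z}^n\cap P\cap(-P)$; its elements are the Ewald points of $P$. An $n$-dimensional polytope in $\mathbb{R}^n$ is smooth if it is simple, rational, and the primitive edge-direction vectors at each vertex form a basis of $\mathbb{Z}^n$. A lattice polytope (vertices in $\mathbb{Z}^n$) with the origin in its interior is reflexive if every facet-defining inequality is of the form $u_F\cdot x\le1$ with $u_F\in\mathbb{Z}^n$ the primitive exterior normal of the facet; monotone means smooth and reflexive. *)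

(* Defs.v *)
From HB Require Import structures.
From mathcomp Require Import all_boot all_order all_algebra.
From mathcomp Require Import all_classical all_reals all_analysis.

Set Implicit Arguments.
Unset Strict Implicit.
Unset Printing Implicit Defensive.

Import Order.TTheory GRing.Theory Num.Theory.
Import numFieldNormedType.Exports.

Local Open Scope card_scope.
Local Open Scope classical_set_scope.
Local Open Scope ring_scope.

(* Points of R^n are row vectors; integer vectors are kept in 'rV[int]_n and
   embedded in R^n by intv. *)
Definition intv (R : realType) (n : nat) (z : 'rV[int]_n) : 'rV[R]_n :=
  map_mx intr z.

Definition int_lattice (R : realType) (n : nat) : set 'rV[R]_n :=
  range (@intv R n).

Definition dot (R : realType) (n : nat) (u v : 'rV[R]_n) : R :=
  \sum_(i < n) u 0 i * v 0 i.

Definition primitive_vec (n : nat) (z : 'rV[int]_n) : Prop :=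
  \big[gcdn/0%N]_(i < n) `|z ord0 i|%N = 1%N.

Definition conv_hull (R : realType) (n : nat) (A : set 'rV[R]_n) :
    set 'rV[R]_n :=
  [set x | exists (m : nat) (p : 'I_m -> 'rV[R]_n) (w : 'I_m -> R),
    [/\ forall i, A (p i), forall i, 0 <= w i,
        \sum_i w i = 1 & x = \sum_i w i *: p i]].

Definition aff_hull (R : realType) (n : nat) (A : set 'rV[R]_n) :
    set 'rV[R]_n :=
  [set x | exists (m : nat) (p : 'I_m -> 'rV[R]_n) (w : 'I_m -> R),
    [/\ forall i, A (p i), \sum_i w i = 1 & x = \sum_i w i *: p i]].

(* The empty set has no dimension in this sense. *)
Definition has_dim (R : realType) (n : nat) (A : set 'rV[R]_n) (d : nat) :
    Prop :=
  exists (x0 : 'rV[R]_n) (U : {vspace 'rV[R]_n}),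
    \dim U = d /\ aff_hull A = [set x0 + u | u in [set` U]].

Definition polytope (R : realType) (n : nat) (P : set 'rV[R]_n) : Prop :=
  exists A : set 'rV[R]_n, finite_set A /\ P = conv_hull A.

(* The sets of maximizers of linear functionals are the nonempty faces of a
   nonempty polytope, P itself included (u = 0). *)
Definition face (R : realType) (n : nat) (P F : set 'rV[R]_n) : Prop :=
  exists u : 'rV[R]_n,
    F = [set x | P x /\ forall y, P y -> dot u y <= dot u x].

Definition vertex (R : realType) (n : nat) (P : set 'rV[R]_n)
    (v : 'rV[R]_n) : Prop :=
  face P [set v].

Definition edge (R : realType) (n : nat) (P E : set 'rV[R]_n) : Prop :=
  face P E /\ has_dim E 1.

(* Only meaningful for n >= 1 and n-dimensional P. *)
Definition facet (R : realType) (n : nat) (P F : set 'rV[R]_n) : Prop :=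
  face P F /\ has_dim F n.-1.

Definition edges_at (R : realType) (n : nat) (P : set 'rV[R]_n)
    (v : 'rV[R]_n) : set (set 'rV[R]_n) :=
  [set E | edge P E /\ E v].

(* u is the primitive direction of the edge E, oriented away from its
   endpoint v. *)
Definition primitive_edge_dir (R : realType) (n : nat) (v : 'rV[R]_n)
    (E : set 'rV[R]_n) (u : 'rV[int]_n) : Prop :=
  primitive_vec u /\
  exists2 t : R, 0 < t & E = [set v + s *: intv R u | s in `[0, t]].

Definition simple_polytope (R : realType) (n : nat) (P : set 'rV[R]_n) :
    Prop :=
  forall v, vertex P v -> edges_at P v #= `I_n.

Definition rational_polytope (R : realType) (n : nat) (P : set 'rV[R]_n) :
    Prop :=
  forall v E, vertex P v -> edges_at P v E ->
    exists u : 'rV[int]_n, primitive_edge_dir v E u.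

(* D is a basis of the free Z-module Z^n, listed as the rows of B. *)
Definition int_basis (n : nat) (D : set 'rV[int]_n) : Prop :=
  exists B : 'M[int]_n,
    D = [set row i B | i in [set: 'I_n]] /\
    forall z : 'rV[int]_n, exists! c : 'rV[int]_n,
      z = \sum_(i < n) c 0 i *: row i B.

Definition smooth_polytope (R : realType) (n : nat) (P : set 'rV[R]_n) :
    Prop :=
  [/\ polytope P, has_dim P n, simple_polytope P, rational_polytope P &
      forall v, vertex P v ->
        int_basis [set u | exists2 E, edges_at P v E &
                                      primitive_edge_dir v E u]].

Definition lattice_polytope (R : realType) (n : nat) (P : set 'rV[R]_n) :
    Prop :=
  polytope P /\ forall v, vertex P v -> int_lattice v.

Definition reflexive_polytope (R : realType) (n : nat) (P : set 'rV[R]_n) :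
    Prop :=
  [/\ lattice_polytope P, interior P 0 &
      forall F, facet P F -> exists u : 'rV[int]_n,
        [/\ primitive_vec u, forall x, P x -> dot (intv R u) x <= 1 &
            F = [set x | P x /\ dot (intv R u) x = 1]]].

Definition monotone_polytope (R : realType) (n : nat) (P : set 'rV[R]_n) :
    Prop :=
  smooth_polytope P /\ reflexive_polytope P.

Definition Ewald_set (R : realType) (n : nat) (P : set 'rV[R]_n) :
    set 'rV[R]_n :=
  @int_lattice R n `&` P `&` [set - x | x in P].

Definition Ewald_counts (R : realType) (n : nat) : set nat :=
  [set m | exists P : set 'rV[R]_n,
    monotone_polytope P /\ Ewald_set P #= `I_m].

Definition is_minimum (A : set nat) (m : nat) : Prop :=
  A m /\ forall k, A k -> (m <= k)%N.

(* The default value 0 is taken only if Ewald_counts R n is empty, which does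
   not happen for n >= 1. *)
Definition Emin (R : realType) (n : nat) : nat :=
  xget 0%N (is_minimum (Ewald_counts R n)).

(* Main.v *)
Require Import Defs.
From mathcomp Require Import all_boot all_order all_algebra.
From mathcomp Require Import all_classical all_reals all_analysis.
From mathcomp Require Import finmap ring lra zify.

Set Implicit Arguments.
Unset Strict Implicit.
Unset Printing Implicit Defensive.

Import Order.TTheory GRing.Theory Num.Theory.
Import numFieldNormedType.Exports.

Local Open Scope card_scope.
Local Open Scope classical_set_scope.
Local Open Scope ring_scope.

(** The upper bounds come from explicit towers of simplex bundles. Over a
    monotone polytope B with an integer functional z >= -1, take all (b, x),
    with x in R^d, such that x_i >= -1 and sum x_i <= 1 + d z(b). The fibre over
    b is a standard d-simplex of edge length d + 1 + d z(b) >= 1, so the result is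
    again monotone ([admissible_bundle]), and its first fibre coordinate is
    again a functional >= -1. At an Ewald point of B the value of z is 0 or
    +-1, and the Ewald points above it correspond to the x in {-1, 0, 1}^d with
    |sum x_i - d z(b)| <= 1: many when z = 0, few when z = +-1. Hence only
    the pair (e0, e1) of the numbers of Ewald points with z = 0 and with
    z = +-1 matters, and a step acts on it by a 2 x 2 matrix ([tower_step]).
    A segment has (1, 2); for d = 3 the matrix is (7 1; 12 3), which has (1, 2)
    as eigenvector of eigenvalue 9. So k tetrahedron steps give 3 * 9^k Ewald
    points in dimension 3k + 1; one more step with triangles, whose matrix is
    (3 1; 4 2), gives 13 * 9^k in dimension 3k + 3, and two more give 59 * 9^k
    in dimension 3k + 5.

    Monotonicity of these polytopes is checked locally. If at every point of
    {x | u.x <= 1 for u in U} the tight normals are among the rows of a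
    unimodular matrix M, then in the coordinates given by M the polyhedron is,
    near that point, an orthant times a vector space. The faces through the
    point, their dimensions, the edges at a vertex and the facets can then be
    read off from M and the dual basis ([admissible_monotone]); this local
    property passes from B to a bundle over B.

    The limit exists because Emin is submultiplicative: the product of two
    monotone polytopes is monotone and its Ewald set is the product of the two
    Ewald sets ([monotone_setprod], [Ewald_set_setprod]). Here the factors are
    arbitrary monotone polytopes, so the proof goes through the definitions:
    faces of a product are products of faces, and dimensions add. Fekete's
    lemma gives the convergence of (ln Emin(n)) / n to its infimum, and the
    dimensions 3k + 1 bound that infimum by (ln 9) / 3. *)

(** * Scalar products and integer vectors *)

Lemma dotC (R : realType) n (u v : 'rV[R]_n) : dot u v = dot v u.
Proof. by apply: eq_bigr => i _; rewrite mulrC. Qed.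

Lemma dotDr (R : realType) n (u v w : 'rV[R]_n) :
  dot u (v + w) = dot u v + dot u w.
Proof. by rewrite -big_split; apply: eq_bigr => i _; rewrite !mxE mulrDr. Qed.

Lemma dotZr (R : realType) n (u v : 'rV[R]_n) a : dot u (a *: v) = a * dot u v.
Proof.
by rewrite /dot mulr_sumr; apply: eq_bigr => i _; rewrite !mxE mulrCA.
Qed.

Lemma dotNr (R : realType) n (u v : 'rV[R]_n) : dot u (- v) = - dot u v.
Proof. by rewrite -scaleN1r dotZr mulN1r. Qed.

Lemma dotBr (R : realType) n (u v w : 'rV[R]_n) :
  dot u (v - w) = dot u v - dot u w.
Proof. by rewrite dotDr dotNr. Qed.

Lemma dot0r (R : realType) n (u : 'rV[R]_n) : dot u 0 = 0.
Proof. by rewrite -(scale0r (0 : 'rV[R]_n)) dotZr mul0r. Qed.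

Lemma dot_sumr (R : realType) n (u : 'rV[R]_n) (I : Type) (r : seq I)
    (P : pred I) (F : I -> 'rV[R]_n) :
  dot u (\sum_(i <- r | P i) F i) = \sum_(i <- r | P i) dot u (F i).
Proof.
apply: (big_morph (dot u)); [exact: dotDr | exact: dot0r].
Qed.

Lemma dot_suml (R : realType) n (u : 'rV[R]_n) (I : Type) (r : seq I)
    (P : pred I) (F : I -> 'rV[R]_n) :
  dot (\sum_(i <- r | P i) F i) u = \sum_(i <- r | P i) dot (F i) u.
Proof. by rewrite dotC dot_sumr; apply: eq_bigr => i _; rewrite dotC. Qed.

Lemma dotZl (R : realType) n (u v : 'rV[R]_n) a : dot (a *: u) v = a * dot u v.
Proof. by rewrite dotC dotZr dotC. Qed.

Lemma dotNl (R : realType) n (u v : 'rV[R]_n) : dot (- u) v = - dot u v.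
Proof. by rewrite dotC dotNr dotC. Qed.

Lemma dot0l (R : realType) n (u : 'rV[R]_n) : dot 0 u = 0.
Proof. by rewrite dotC dot0r. Qed.

Lemma dot_self_ge0 (R : realType) n (u : 'rV[R]_n) : 0 <= dot u u.
Proof. by apply: sumr_ge0 => i _; rewrite -expr2 sqr_ge0. Qed.

Lemma dot_self_eq0 (R : realType) n (u : 'rV[R]_n) : dot u u = 0 -> u = 0.
Proof.
move/eqP; rewrite psumr_eq0 => [|i _]; last by rewrite -expr2 sqr_ge0.
move=> /allP h; apply/rowP => i; rewrite mxE.
by have := h i (mem_index_enum _); rewrite -expr2 sqrf_eq0 => /eqP.
Qed.

Lemma dot_row_mx (R : realType) n m (u1 : 'rV[R]_n) (u2 : 'rV[R]_m) x :
  dot (row_mx u1 u2) x = dot u1 (lsubmx x) + dot u2 (rsubmx x).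
Proof.
rewrite /dot big_split_ord /=; congr (_ + _); apply: eq_bigr => i _.
  by rewrite row_mxEl mxE.
by rewrite row_mxEr mxE.
Qed.

Lemma dot_lrsub (R : realType) n m (u x : 'rV[R]_(n + m)) :
  dot u x = dot (lsubmx u) (lsubmx x) + dot (rsubmx u) (rsubmx x).
Proof. by rewrite -{1}(hsubmxK u) dot_row_mx. Qed.

Lemma intv0 (R : realType) n : intv R (0 : 'rV[int]_n) = 0.
Proof. exact: map_mx0. Qed.

Lemma intv_row_mx (R : realType) n m (z1 : 'rV[int]_n) (z2 : 'rV[int]_m) :
  intv R (row_mx z1 z2) = row_mx (intv R z1) (intv R z2).
Proof. exact: map_row_mx. Qed.

Lemma intvN (R : realType) n (z : 'rV[int]_n) : intv R (- z) = - intv R z.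
Proof. by rewrite /intv map_mxN. Qed.

Lemma intvZ (R : realType) n a (z : 'rV[int]_n) :
  intv R (a *: z) = a%:~R *: intv R z.
Proof. by rewrite /intv map_mxZ. Qed.

Lemma intv_inj (R : realType) n : injective (@intv R n).
Proof.
move=> z1 z2 /rowP e; apply/rowP => i; have := e i; rewrite !mxE.
exact: intr_inj.
Qed.

Lemma intv_eq0 (R : realType) n (u : 'rV[int]_n) : intv R u = 0 -> u = 0.
Proof. by move=> u0; apply: (@intv_inj R); rewrite u0 intv0. Qed.

Lemma dot_intv (R : realType) n (u z : 'rV[int]_n) :
  dot (intv R u) (intv R z) = (\sum_i u 0 i * z 0 i)%:~R.
Proof. by rewrite rmorph_sum; apply: eq_bigr => i _; rewrite !mxE rmorphM. Qed.

Lemma mulmx_dot (R : realType) n m (x : 'rV[R]_n) (A : 'M[R]_(n, m)) j :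
  (x *m A) 0 j = dot x (row j A^T).
Proof. by rewrite mxE; apply: eq_bigr => i _; rewrite !mxE. Qed.

(** * Cardinalities by duplicate-free lists *)

Lemma card_eq_seqP (T : choiceType) (A : set T) k :
  A #= `I_k <-> exists s : seq T, [/\ uniq s, size s = k & A = [set` s]].
Proof.
split=> [Ak|[s [us <- ->]]].
  have [X AX] : exists X : {fset T}, A = [set` X].
    by apply/finite_fsetP/finite_setP; exists k.
  exists (enum_fset X); split => //.
  by move: Ak; rewrite AX => /card_eq_fsetP.
have -> : [set` s] = [set` [fset x in s]%fset].
  by apply/seteqP; split => x /=; rewrite inE.
by apply/card_eq_fsetP; rewrite card_fseq undup_id.
Qed.

(** * Convex and affine hulls *)

Lemma big_option (V : nmodType) (I : finType) (F : option I -> V) :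
  \sum_o F o = F None + \sum_i F (Some i).
Proof.
rewrite (bigD1 None) //=; congr (_ + _).
rewrite (reindex_omap Some id) /=; last by case.
by apply: eq_bigl => i; rewrite eqxx.
Qed.

Lemma conv_hull_fin (R : realType) n (A : set 'rV[R]_n) (I : finType)
    (p : I -> 'rV[R]_n) (w : I -> R) :
  (forall i, A (p i)) -> (forall i, 0 <= w i) -> \sum_i w i = 1 ->
  conv_hull A (\sum_i w i *: p i).
Proof.
move=> Ap w0 w1; exists #|I|, (p \o enum_val), (w \o enum_val).
split=> /=; [by move=> i; apply: Ap | by move=> i; apply: w0 | |].
  by rewrite -big_enum_val.
by rewrite -(big_enum_val (fun i => w i *: p i)).
Qed.

Lemma aff_hull_fin (R : realType) n (A : set 'rV[R]_n) (I : finType)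
    (p : I -> 'rV[R]_n) (w : I -> R) :
  (forall i, A (p i)) -> \sum_i w i = 1 ->
  aff_hull A (\sum_i w i *: p i).
Proof.
move=> Ap w1; exists #|I|, (p \o enum_val), (w \o enum_val).
split=> /=; [by move=> i; apply: Ap | |].
  by rewrite -big_enum_val.
by rewrite -(big_enum_val (fun i => w i *: p i)).
Qed.

Lemma sub_conv_hull (R : realType) n (A : set 'rV[R]_n) : A `<=` conv_hull A.
Proof.
move=> x Ax; have := @conv_hull_fin R n A 'I_1 (fun=> x) (fun=> 1).
by rewrite !big_ord1 scale1r; apply.
Qed.

Lemma sub_aff_hull (R : realType) n (A : set 'rV[R]_n) : A `<=` aff_hull A.
Proof.
move=> x Ax; have := @aff_hull_fin R n A 'I_1 (fun=> x) (fun=> 1).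
by rewrite !big_ord1 scale1r; apply.
Qed.

Lemma aff_hull0 (R : realType) n (A : set 'rV[R]_n) x : aff_hull A x -> A !=set0.
Proof.
case=> [[|m]] [p [w [Ap + _]]]; last by exists (p ord0).
by rewrite big_ord0 => /esym/eqP; rewrite oner_eq0.
Qed.

(** * Dimension *)

Lemma has_dim_nonempty (R : realType) n (A : set 'rV[R]_n) d : has_dim A d -> A !=set0.
Proof.
move=> [x [U [_ AU]]]; apply: (@aff_hull0 _ _ _ x); rewrite AU.
by exists 0; [exact: mem0v | rewrite addr0].
Qed.

Lemma has_dim_uniq (R : realType) n (A : set 'rV[R]_n) d e :
  has_dim A d -> has_dim A e -> d = e.
Proof.
move=> [x [U [<- AU]]] [y [V [<-]]]; rewrite {}AU => /seteqP [xy yx].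
have sub (x' y' : 'rV[R]_n) (U' V' : {vspace 'rV[R]_n}) :
    [set x' + u | u in [set` U']] `<=` [set y' + u | u in [set` V']] ->
    (U' <= V')%VS.
  move=> h; have [v0 /= v0V e0] : [set y' + u | u in [set` V']] x'.
    by apply: h; exists 0; [exact: mem0v | rewrite addr0].
  apply/subvP => u uU; have [v vV e1] : [set y' + u | u in [set` V']] (x' + u).
    by apply: h; exists u.
  suff -> : u = v - v0 by rewrite memvB.
  by apply: (addrI x'); rewrite -e1 -[in RHS]e0 -addrA (addrC v0) subrK.
by congr (\dim _); apply/eqP; rewrite eqEsubv (sub _ _ _ _ xy) (sub _ _ _ _ yx).
Qed.

Lemma has_dim_le (R : realType) n (A : set 'rV[R]_n) d : has_dim A d -> (d <= n)%N.
Proof.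
move=> [x [U [<- _]]]; apply: leq_trans (dimvS (subvf U)) _.
by rewrite dimvf /dim /= mul1n.
Qed.

Lemma has_dim0 (R : realType) n (A : set 'rV[R]_n) : has_dim A 0 -> exists x, A = [set x].
Proof.
move=> dA; have [x [U [/eqP + AU]]] := dA; rewrite dimv_eq0 => /eqP U0.
have Ax y : A y -> y = x.
  move=> /sub_aff_hull; rewrite AU => -[u /=]; rewrite U0 memv0 => /eqP -> <-.
  by rewrite addr0.
have [y Ay] := has_dim_nonempty dA.
exists x; apply/seteqP; split => z /=; first exact: Ax.
by move=> ->; rewrite -(Ax _ Ay).
Qed.

Lemma has_dim_set1 (R : realType) n (x : 'rV[R]_n) : has_dim [set x] 0.
Proof.
exists x, 0%VS; rewrite dimv0; split => //; apply/seteqP; split => y.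
  case=> m [p [w [/= px w1 ->]]]; exists 0; first exact: mem0v.
  under eq_bigr do rewrite px.
  by rewrite -scaler_suml w1 scale1r addr0.
move=> [u /=]; rewrite memv0 => /eqP -> <-; rewrite addr0.
exact: sub_aff_hull.
Qed.

(** * Faces *)

Lemma face_self (R : realType) n (P : set 'rV[R]_n) : face P P.
Proof.
by exists 0; apply/seteqP; split=> [x Px|x []//]; split=> // y _; rewrite !dot0l.
Qed.

Lemma vertex_in (R : realType) n (P : set 'rV[R]_n) v : vertex P v -> P v.
Proof. by case=> c /seteqP [/(_ v erefl) []]. Qed.

(** The functional that cuts out F is constant on F, hence on its affine hull;
    if that is the whole space, the functional is zero. *)
Lemma has_dim_full_face (R : realType) n (P F : set 'rV[R]_n) :
  face P F -> has_dim F n -> F = P.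
Proof.
move=> [c FE] dF; have [x [U [dU FU]]] := dF.
have UF : U = fullv.
  by apply/eqP; rewrite eqEdim subvf dimvf /= /dim /= mul1n dU /=.
have [y0 Fy0] := has_dim_nonempty dF.
have cst y : F y -> dot c y = dot c y0.
  move: Fy0; rewrite FE => -[Py0 m0] [Py m]; apply/eqP.
  by rewrite eq_le m0 //= m.
have cst' y : dot c y = dot c y0.
  have : aff_hull F y by rewrite FU; exists (y - x); rewrite /= ?UF ?memvf // addrC subrK.
  case=> m [p [w [Fp w1 ->]]]; rewrite dot_sumr.
  under eq_bigr do rewrite dotZr cst //.
  by rewrite -mulr_suml w1 mul1r.
rewrite FE; apply/seteqP; split => [y [] //|y Py].
split=> // z Pz.
by rewrite (cst' y) (cst' z).
Qed.

Lemma polytope_dot_le (R : realType) n (P : set 'rV[R]_n) (c : 'rV[R]_n) :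
  polytope P -> exists K, forall x, P x -> dot c x <= K.
Proof.
case=> A [/finite_seqP [s ->] ->].
have [K HK] : exists K, forall x, x \in s -> dot c x <= K.
  elim: s => [|y s [K HK]]; first by exists 0.
  exists (Num.max (dot c y) K) => x; rewrite inE le_max.
  by case/predU1P=> [->|/HK ->]; rewrite ?lexx ?orbT.
exists K => x [m [p [w [sp w0 w1 ->]]]]; rewrite dot_sumr -[K]mul1r -w1 mulr_suml.
by apply: ler_sum => i _; rewrite dotZr ler_wpM2l // HK //; apply: sp.
Qed.

(** * Polyhedra with unimodular local cones *)

Definition hpoly (R : realType) n (U : seq 'rV[int]_n) : set 'rV[R]_n :=
  [set x | forall u, u \in U -> dot (intv R u) x <= 1].
Arguments hpoly : clear implicits.

(** Smoothness in a form that makes sense at every point of the polyhedron, and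
    not only at the vertices: up to the unimodular change of coordinates M, it
    is near x an orthant times a vector space. *)
Definition unimodular_at (R : realType) n (U : seq 'rV[int]_n) (M : 'M[int]_n)
    (x : 'rV[R]_n) : Prop :=
  M \in unitmx /\
  forall u, u \in U -> dot (intv R u) x = 1 -> exists i, u = row i M.

(** The rows of M and the vectors [dual_row M j] are dual bases of Z^n. *)
Definition dual_row n (M : 'M[int]_n) (j : 'I_n) : 'rV[int]_n :=
  row j (invmx M)^T.

Lemma dual_row_pairing n (M : 'M[int]_n) i j : M \in unitmx ->
  \sum_k row i M 0 k * dual_row M j 0 k = (i == j)%:R.
Proof.
move=> /mulmxV /matrixP /(_ i j); rewrite !mxE => <-.
by apply: eq_bigr => k _; rewrite !mxE.
Qed.

Lemma dot_dual_row (R : realType) n (M : 'M[int]_n) i j : M \in unitmx ->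
  dot (intv R (row i M)) (intv R (dual_row M j)) = (i == j)%:R.
Proof. by move=> Mu; rewrite dot_intv dual_row_pairing // natz. Qed.

Lemma dual_row_decomp (R : realType) n (M : 'M[int]_n) (x : 'rV[R]_n) :
  M \in unitmx ->
  x = \sum_j dot (intv R (row j M)) x *: intv R (dual_row M j).
Proof.
move=> Mu; set MR := map_mx intr M : 'M[R]_n.
set WR := map_mx intr (invmx M) : 'M[R]_n.
have e : WR *m MR = 1%:M by rewrite -map_mxM mulVmx // map_mx1.
rewrite -{1}(mulmx1 x) -[1%:M]trmx1 -e trmx_mul mulmxA mulmx_sum_row.
apply: eq_bigr => j _; rewrite mulmx_dot trmxK dotC; congr (dot _ _ *: _).
  by apply/rowP => k; rewrite !mxE.
by apply/rowP => k; rewrite !mxE.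
Qed.

Lemma dot_dual_decomp (R : realType) n (M : 'M[int]_n) (c x : 'rV[R]_n) :
  M \in unitmx ->
  dot c x = \sum_j dot c (intv R (dual_row M j)) * dot (intv R (row j M)) x.
Proof.
move=> Mu; rewrite {1}(dual_row_decomp x Mu) dot_sumr.
by apply: eq_bigr => j _; rewrite dotZr mulrC.
Qed.

(** The gcd of the entries divides every integer combination of them. *)
Lemma primitive_vec_pairing n (m z : 'rV[int]_n) :
  \sum_k m 0 k * z 0 k = 1 -> primitive_vec z.
Proof.
move=> mz; rewrite /primitive_vec; set g := \big[gcdn/0%N]_i _.
have gz i : (g %| `|z ord0 i|)%N by rewrite /g (bigD1 i) //= dvdn_gcdl.
have : (g%:Z %| 1%R)%Z.
  rewrite -mz; apply: (big_ind (fun a => (g%:Z %| a)%Z)) => //.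
  - by move=> a b; exact: rpredD.
  - by move=> i _; rewrite dvdz_mull // dvdzE /=.
by rewrite dvdzE /= dvdn1 => /eqP.
Qed.

Lemma primitive_row n (M : 'M[int]_n) j : M \in unitmx -> primitive_vec (row j M).
Proof.
move=> Mu; apply: (@primitive_vec_pairing _ (dual_row M j)).
under eq_bigr do rewrite mulrC.
by rewrite dual_row_pairing // eqxx.
Qed.

(** The ratio u : w is the integer pairing of m with u. It divides all entries
    of u, and these have gcd 1. *)
Lemma primitive_ray_uniq (R : realType) n (m u w : 'rV[int]_n) (a b : R) :
  0 < a -> 0 < b -> a *: intv R u = b *: intv R w ->
  \sum_k m 0 k * w 0 k = 1 -> primitive_vec u -> u = w.
Proof.
move=> a0 b0 e mw pu; set k : int := \sum_k m 0 k * u 0 k.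
have ak : a * k%:~R = b.
  by rewrite /k -(dot_intv R) -dotZr e dotZr dot_intv mw mulr1.
have k0 : (0 < k)%R by rewrite -(ltr0z R) -(pmulr_rgt0 _ a0) ak.
have ukw : u = k *: w.
  apply: (@intv_inj R); rewrite intvZ; apply: (scalerI (lt0r_neq0 a0)).
  by rewrite e scalerA ak.
suff k1 : k = 1 by rewrite ukw k1 scale1r.
have : (`|k| %| 1)%N.
  rewrite -pu; apply: (big_ind (fun g => (`|k| %| g)%N)) => //.
  - by move=> x y; rewrite dvdn_gcd => -> ->.
  - by move=> i _; rewrite ukw mxE abszM dvdn_mulr.
by rewrite dvdn1; move: k0; clear; lia.
Qed.

(** Moving from a point against no active inequality stays inside for a
    while, since the finitely many other inequalities are strict there. *)
Lemma hpoly_feasible (R : realType) n (U : seq 'rV[int]_n) (x d : 'rV[R]_n) :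
  hpoly R n U x ->
  (forall u, u \in U -> dot (intv R u) x = 1 -> dot (intv R u) d <= 0) ->
  exists2 e : R, 0 < e & forall s, 0 <= s <= e -> hpoly R n U (x + s *: d).
Proof.
elim: U => [|u U IH] Px act; first by exists 1.
have [|v vU|e e0 He] := IH.
- by move=> v vU; apply: Px; rewrite inE vU orbT.
- by apply: act; rewrite inE vU orbT.
have ux : dot (intv R u) x <= 1 by apply: Px; rewrite mem_head.
suff [e' e'0 He'] : exists2 e : R, 0 < e &
    forall s, 0 <= s <= e -> dot (intv R u) (x + s *: d) <= 1.
  exists (Num.min e e'); first by rewrite lt_min e0.
  move=> s; rewrite le_min => /and3P [s0 se se'] v.
  by rewrite inE => /predU1P [->|]; [apply: He'; rewrite s0 | apply: He; rewrite s0].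
move: ux; rewrite le_eqVlt => /predU1P [ux|ux].
  exists 1 => // s /andP [s0 _]; rewrite dotDr dotZr ux gerDl mulr_ge0_le0 //.
  by apply: act; rewrite ?mem_head.
(* The denominator 1 + |b| exceeds u.d and does not vanish when u.d = 0. *)
set b := dot (intv R u) d; have b1 : 0 < 1 + `|b| by rewrite ltr_pwDl.
exists ((1 - dot (intv R u) x) / (1 + `|b|)).
  by rewrite divr_gt0 // subr_gt0.
move=> s /andP [s0]; rewrite ler_pdivlMr // dotDr dotZr -/b.
have : s * b <= s * `|b| by rewrite ler_wpM2l // ler_norm.
by lra.
Qed.

Lemma unimodular_feasible (R : realType) n (U : seq 'rV[int]_n) (M : 'M[int]_n)
    (x d : 'rV[R]_n) :
  hpoly R n U x -> unimodular_at U M x ->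
  (forall i, row i M \in U -> dot (intv R (row i M)) x = 1 ->
    dot (intv R (row i M)) d <= 0) ->
  exists2 e : R, 0 < e & forall s, 0 <= s <= e -> hpoly R n U (x + s *: d).
Proof.
move=> Px [_ act] h; apply: hpoly_feasible => // u uU ux.
by have [i ui] := act _ uU ux; move: uU ux; rewrite ui; apply: h.
Qed.

(** Complementary slackness. From x one can always move a little in the
    direction opposite to a dual basis vector, and also along it when the
    corresponding row is not a tight normal; so a functional maximal at x has
    nonnegative coordinates in the rows of M, supported on the tight ones. *)
Lemma maximizer_coord (R : realType) n (U : seq 'rV[int]_n) (M : 'M[int]_n)
    (x c : 'rV[R]_n) :
  hpoly R n U x -> unimodular_at U M x ->
  (forall y, hpoly R n U y -> dot c y <= dot c x) ->
  forall j, 0 <= dot c (intv R (dual_row M j)) /\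
    (dot c (intv R (dual_row M j)) != 0 ->
      row j M \in U /\ dot (intv R (row j M)) x = 1).
Proof.
move=> Px Mx mx j; have [Mu act] := Mx.
have noimp d : dot c d > 0 -> ~ (forall i, row i M \in U ->
   dot (intv R (row i M)) x = 1 -> dot (intv R (row i M)) d <= 0).
  move=> cd /(unimodular_feasible Px Mx) [e e0 /(_ e)].
  rewrite lexx ltW //= => /(_ isT) /mx; apply/negP; rewrite -ltNge dotDr dotZr.
  by rewrite ltrDl mulr_gt0.
have c0 : 0 <= dot c (intv R (dual_row M j)).
  rewrite leNgt; apply/negP => h; apply: (@noimp (- intv R (dual_row M j))).
    by rewrite dotNr oppr_gt0.
  by move=> i _ _; rewrite dotNr dot_dual_row // oppr_le0 ler0n.
split=> // cj; apply: contrapT => nact.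
apply: (@noimp (intv R (dual_row M j))); first by rewrite lt_def cj.
move=> i iU ix; rewrite dot_dual_row //; case: eqP => // ij.
by case: nact; rewrite -ij.
Qed.

(** The faces through a point x turn out to be the slices whose rows J are
    tight at x. *)
Definition slice (R : realType) n (U : seq 'rV[int]_n) (M : 'M[int]_n)
    (J : {set 'I_n}) : set 'rV[R]_n :=
  [set y | hpoly R n U y /\ forall j, j \in J -> dot (intv R (row j M)) y = 1].
Arguments slice : clear implicits.

Definition tight (R : realType) n (U : seq 'rV[int]_n) (M : 'M[int]_n)
    (J : {set 'I_n}) (x : 'rV[R]_n) : Prop :=
  forall j, j \in J -> row j M \in U /\ dot (intv R (row j M)) x = 1.

(** With complementary slackness, a maximizer of c attains the bound 1 of
    every row that c involves. *)
Lemma argmax_slice (R : realType) n (U : seq 'rV[int]_n) (M : 'M[int]_n)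
    (x c : 'rV[R]_n) (J : {set 'I_n}) :
  M \in unitmx -> hpoly R n U x -> tight U M J x ->
  (forall j, 0 <= dot c (intv R (dual_row M j))) ->
  (forall j, (j \in J) = (dot c (intv R (dual_row M j)) != 0)) ->
  [set y | hpoly R n U y /\ forall z, hpoly R n U z -> dot c z <= dot c y] =
  slice R n U M J.
Proof.
move=> Mu Px tJ c0 cJ.
have cE y : dot c y = \sum_(j in J)
    dot c (intv R (dual_row M j)) * dot (intv R (row j M)) y.
  rewrite (dot_dual_decomp _ _ Mu) (bigID (mem J)) /= [X in _ + X]big1 ?addr0 //.
  by move=> j; rewrite cJ negbK => /eqP ->; rewrite mul0r.
have le1 y : hpoly R n U y -> forall j, j \in J -> 
   dot c (intv R (dual_row M j)) * dot (intv R (row j M)) y <=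
   dot c (intv R (dual_row M j)) * 1.
  by move=> Py j jJ; rewrite ler_wpM2l //; apply: Py; have [] := tJ j jJ.
apply/seteqP; split=> y [Py] h; split=> //.
  have : dot c y = dot c x.
    apply/eqP; rewrite eq_le h // andbT !cE; apply: ler_sum => j jJ.
    by have [_ ->] := tJ j jJ; apply: le1.
  rewrite [in RHS]cE; under [in RHS]eq_bigr => j jJ do rewrite (tJ j jJ).2.
  rewrite cE => /eqP; rewrite -subr_eq0 -oppr_eq0 opprB -sumrB.
  rewrite psumr_eq0 => [/allP h0 j jJ|j jJ]; last by rewrite subr_ge0 le1.
  have := h0 j (mem_index_enum _); rewrite jJ /= -mulrBr mulf_eq0.
  by rewrite (negbTE (_ : _ != 0)) -?cJ // subr_eq0 => /eqP.
move=> z Pz; rewrite !cE; apply: ler_sum => j jJ; rewrite (h j jJ).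
exact: le1.
Qed.

Lemma dual_row_inj n (M : 'M[int]_n) : M \in unitmx -> injective (dual_row M).
Proof.
move=> Mu i j e; have := dual_row_pairing i i Mu.
by rewrite e dual_row_pairing // eqxx; case: eqP.
Qed.

Lemma dim_dual_span (R : realType) n (M : 'M[int]_n) (J : {set 'I_n}) :
  M \in unitmx ->
  \dim <<[seq intv R (dual_row M j) | j <- enum J]>>%VS = #|J|.
Proof.
move=> Mu; set X := [seq _ | j <- _].
have injd : injective (fun j => intv R (dual_row M j)).
  by move=> i j /intv_inj /dual_row_inj; apply.
suff /eqP -> : free X by rewrite size_map -cardE.
set Y := [tuple intv R (dual_row M j) | j < n].
have -> : free X = free [seq v <- Y | v \in X].
  apply/perm_free/uniq_perm; rewrite ?filter_uniq ?map_inj_uniq -?enumT ?enum_uniq //.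
  move=> v; rewrite mem_filter andb_idr // => /mapP [j _ ->].
  by apply/mapP; exists j; rewrite ?mem_enum.
apply/filter_free/freeP => k; under eq_bigr do rewrite -tnth_nth tnth_mktuple.
move=> e j; have := congr1 (dot (intv R (row j M))) e.
rewrite dot0r dot_sumr (bigD1 j) //= big1 => [|i ij].
  by rewrite dotZr dot_dual_row // eqxx mulr1 addr0.
by rewrite dotZr dot_dual_row // eq_sym (negbTE ij) mulr0.
Qed.

(** The slice contains a small segment in the direction opposite to each dual
    vector of index outside J, and its affine hull contains no direction on
    which a row of J is nonzero. *)
Lemma has_dim_slice (R : realType) n (U : seq 'rV[int]_n) (M : 'M[int]_n)
    (x : 'rV[R]_n) (J : {set 'I_n}) :
  unimodular_at U M x -> hpoly R n U x -> tight U M J x ->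
  has_dim (slice R n U M J) (n - #|J|).
Proof.
move=> Mx Px tJ; have [Mu act] := Mx.
set D := fun j => intv R (dual_row M j).
exists x, <<[seq D j | j <- enum (~: J)]>>%VS.
split; first by rewrite dim_dual_span // cardsCs finset.setCK card_ord.
(* Every point of x + span is an affine combination of x and of the points
   x - e_j d_j, where j is outside J; these all lie in the slice. *)
have /choice [e He] : forall j, exists e : R, 0 < e /\ hpoly R n U (x - e *: D j).
  move=> j; have [|e e0 /(_ e)] := unimodular_feasible (d := - D j) Px Mx.
    by move=> i _ _; rewrite dotNr dot_dual_row // oppr_le0 ler0n.
  by rewrite lexx ltW // scalerN => /(_ isT) h; exists e.
apply/seteqP; split=> y.
  case=> m [p [w [Sp w1 ->]]]; set v := \sum_i _.
  exists (v - x); last by rewrite addrC subrK.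
  rewrite /= (dual_row_decomp (v - x) Mu); apply: rpred_sum => j _.
  have [jJ|jJ] := boolP (j \in J); last first.
    by apply/memvZ/memv_span/map_f; rewrite mem_enum inE.
  rewrite dotBr (tJ j jJ).2 dot_sumr.
  under eq_bigr => i _ do rewrite dotZr (Sp i).2 // mulr1.
  by rewrite w1 subrr scale0r mem0v.
case=> u /= uU <-{y}.
have uJ j : j \in J -> dot (intv R (row j M)) u = 0.
  move: uU => /coord_span -> jJ; rewrite dot_sumr big1 // => i _.
  rewrite dotZr; have : [seq D j | j <- enum (~: J)]`_i \in [seq D j | j <- enum (~: J)].
    by rewrite mem_nth // size_map -cardE; apply: ltn_ord.
  case/mapP => k; rewrite mem_enum inE => kJ ->.
  rewrite dot_dual_row //; case: eqP => [jk|]; last by rewrite mulr0.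
  by rewrite -jk jJ in kJ.
set b := fun j => dot (intv R (row j M)) u.
pose p (o : option 'I_n) := if o is Some j then
  if j \in J then x else x - e j *: D j else x.
pose w (o : option 'I_n) := if o is Some j then - b j / e j else
  1 + \sum_j b j / e j.
have -> : x + u = \sum_o w o *: p o.
  rewrite big_option /= {1}(dual_row_decomp u Mu).
  rewrite scalerDl scale1r -addrA; congr (_ + _).
  rewrite scaler_suml -big_split /=; apply: eq_bigr => j _.
  rewrite mulNr scaleNr -/(b j); case: ifP => jJ.
    by rewrite /b uJ // !(scale0r, mul0r, subrr).
  rewrite scalerBr opprB addrC -addrA [X in _ + X]addrC subrr addr0.
  by rewrite scalerA divfK // gt_eqF // (He j).1.
apply: aff_hull_fin => [[j|] /=|]; rewrite ?big_option /=.
- case: ifP => jJ; first by split=> // i iJ; rewrite (tJ i iJ).2.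
  split; first exact: (He j).2.
  move=> i iJ; rewrite dotBr dotZr (tJ i iJ).2 dot_dual_row //.
  by case: eqP => [ij|_]; [rewrite ij jJ in iJ | rewrite mulr0 subr0].
- by split=> // i iJ; rewrite (tJ i iJ).2.
by rewrite -addrA -big_split /= big1 ?addr0 // => j _; rewrite mulNr subrr.
Qed.

(** Each of the finitely many inequalities holds on the whole ray or on an
    initial segment of it. *)
Lemma hpoly_ray (R : realType) n (U : seq 'rV[int]_n) (x d : 'rV[R]_n) :
  hpoly R n U x ->
  (forall s, 0 <= s -> hpoly R n U (x + s *: d)) \/
  exists t, forall s, 0 <= s -> hpoly R n U (x + s *: d) <-> s <= t.
Proof.
elim: U => [|u U IH] Px; first by left.
have consP y : hpoly R n (u :: U) y <-> dot (intv R u) y <= 1 /\ hpoly R n U y.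
  split=> [h|[h1 h2] w]; last by rewrite inE => /predU1P [->|/h2].
  by split=> [|w wU]; apply: h; rewrite inE ?eqxx ?wU ?orbT.
have [ux {}/IH IH] := (consP x).1 Px.
have [d0|d0] := lerP (dot (intv R u) d) 0.
  have h s : 0 <= s -> dot (intv R u) (x + s *: d) <= 1.
    by move=> s0; rewrite dotDr dotZr -[1]addr0 lerD // mulr_ge0_le0.
  case: IH => [IH|[t IH]]; first by left=> s s0; apply/consP; split; [exact: h|exact: IH].
  right; exists t => s s0; rewrite -IH //; split; first by case/consP.
  by move=> h2; apply/consP; split=> //; exact: h.
pose t0 := (1 - dot (intv R u) x) / dot (intv R u) d.
have h s : (dot (intv R u) (x + s *: d) <= 1) = (s <= t0).
  by rewrite ler_pdivlMr // dotDr dotZr lerBrDl.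
case: IH => [IH|[t IH]]; right.
  exists t0 => s s0; rewrite -h; split; first by case/consP.
  by move=> h2; apply/consP; split=> //; exact: IH.
exists (Num.min t0 t) => s s0; rewrite le_min -h; split.
  by case/consP=> -> /(IH _ s0) ->.
by case/andP=> h1 h2; apply/consP; split=> //; apply/IH.
Qed.

Lemma hpoly_interior0 (R : realType) n (U : seq 'rV[int]_n) :
  interior (hpoly R n U) 0.
Proof.
have [e e0 He] : exists2 e : R, 0 < e & forall x : 'rV[R]_n,
    (forall i, `|x 0 i| < e) -> hpoly R n U x.
  elim: U => [|u U [e e0 IH]]; first by exists 1.
  pose K : R := 1 + \sum_i `|intv R u 0 i|.
  have K0 : 0 < K by rewrite ltr_pwDl // sumr_ge0.
  exists (Num.min e K^-1); first by rewrite lt_min e0 invr_gt0.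
  move=> x hx w; rewrite inE => /predU1P [->|]; last first.
    by apply: IH => i; have := hx i; rewrite lt_min => /andP [].
  apply: (@le_trans _ _ (\sum_i `|intv R u 0 i| * K^-1)).
    apply: ler_sum => i _; apply: le_trans (ler_norm _) _.
    rewrite normrM ler_wpM2l // ltW //.
    by have := hx i; rewrite lt_min => /andP [].
  by rewrite -mulr_suml ler_pdivrMr // mul1r lerDr.
apply/nbhs_ballP; exists e => //= x xe; apply: He => i.
by case: xe => _ /(_ 0 i); rewrite /ball /= mxE sub0r normrN.
Qed.

(** * Faces of admissible polyhedra *)

(** Being a polytope is required separately: the local condition does not
    exclude unbounded polyhedra. *)
Definition admissible (R : realType) n (U : seq 'rV[int]_n) : Prop :=
  polytope (hpoly R n U) /\
  forall x, hpoly R n U x -> exists M, unimodular_at U M x.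
Arguments admissible : clear implicits.

Lemma face_slice (R : realType) n (U : seq 'rV[int]_n) (M : 'M[int]_n)
    (F : set 'rV[R]_n) (x : 'rV[R]_n) :
  face (hpoly R n U) F -> F x -> unimodular_at U M x ->
  exists J : {set 'I_n},
    [/\ tight U M J x, F = slice R n U M J & has_dim F (n - #|J|)].
Proof.
move=> [c ->] [Px mx] Mx; have [Mu _] := Mx.
have coord := maximizer_coord Px Mx mx.
pose J := [set j | dot c (intv R (dual_row M j)) != 0]%SET.
have tJ : tight U M J x by move=> j; rewrite inE => /((coord j).2).
have cJ j : (j \in J) = (dot c (intv R (dual_row M j)) != 0) by rewrite inE.
have FJ := argmax_slice Mu Px tJ (fun j => (coord j).1) cJ.
by exists J; rewrite FJ; split=> //; exact: (has_dim_slice Mx Px tJ).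
Qed.

(** A slice of dimension 0 involves all n rows. *)
Lemma vertex_tight (R : realType) n (U : seq 'rV[int]_n) (M : 'M[int]_n)
    (v : 'rV[R]_n) :
  vertex (hpoly R n U) v -> unimodular_at U M v -> tight U M [set: 'I_n]%SET v.
Proof.
move=> Vv Mv; have [J [tJ _ dJ]] := face_slice Vv erefl Mv.
suff -> : [set: 'I_n]%SET = J by [].
apply/esym/eqP; rewrite eqEcard finset.subsetT cardsT card_ord -subn_eq0.
exact/eqP/(has_dim_uniq dJ (has_dim_set1 v)).
Qed.

(** Fixing all rows but one leaves the ray opposite to a dual vector, and the
    ray leaves the polytope at some positive time because the polytope is
    bounded. *)
Lemma edge_segment (R : realType) n (U : seq 'rV[int]_n) (M : 'M[int]_n)
    (v : 'rV[R]_n) i :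
  polytope (hpoly R n U) -> hpoly R n U v -> unimodular_at U M v ->
  tight U M [set: 'I_n]%SET v ->
  exists2 t : R, 0 < t & slice R n U M (~: [set i])%SET =
    [set v + s *: - intv R (dual_row M i) | s in `[0, t]].
Proof.
move=> pP Pv Mv tv; have [Mu _] := Mv; set d := - intv R (dual_row M i).
have dn0 : 0 < dot d d.
  rewrite lt_def dot_self_ge0 andbT; apply/eqP => /dot_self_eq0.
  move=> /(congr1 (dot (intv R (row i M)))).
  by rewrite dot0r dotNr dot_dual_row // eqxx => /eqP; rewrite oppr_eq0 oner_eq0.
have [e e0 He] : exists2 e : R, 0 < e &
    forall s, 0 <= s <= e -> hpoly R n U (v + s *: d).
  apply: (unimodular_feasible Pv Mv) => k _ _.
  by rewrite dotNr dot_dual_row // oppr_le0 ler0n.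
have [all_s|[t Ht]] := hpoly_ray d Pv.
  have [K HK] := polytope_dot_le d pP.
  pose s := (`|K - dot d v| + 1) / dot d d.
  have s0 : 0 <= s by rewrite divr_ge0 // ltW.
  have := HK _ (all_s s s0); rewrite dotDr dotZr divfK ?gt_eqF //.
  by have := ler_norm (K - dot d v); lra.
have t0 : 0 < t.
  by apply: (lt_le_trans e0); apply/(Ht _ (ltW e0))/He; rewrite lexx ltW.
have rowd k : dot (intv R (row k M)) d = - (k == i)%:R.
  by rewrite dotNr dot_dual_row.
exists t => //; apply/seteqP; split=> y.
  move=> [Py yJ]; pose s := 1 - dot (intv R (row i M)) y.
  have s0 : 0 <= s by rewrite subr_ge0; apply: Py; have [] := tv i (finset.in_setT _).
  have ye : y = v + s *: d.
    rewrite -[LHS](subrK v) addrC; congr (_ + _).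
    rewrite (dual_row_decomp (y - v) Mu) (bigD1 i) //= big1 ?addr0 => [|k ki].
      rewrite dotBr (tv i (finset.in_setT _)).2 scalerN -scaleNr opprB //.
    by rewrite dotBr (tv k (finset.in_setT _)).2 yJ ?inE // subrr scale0r.
  by exists s => //=; rewrite in_itv /= s0; apply/Ht; rewrite // -ye.
move=> [s] /=; rewrite in_itv /= => /andP [s0 st] <-; split; first exact/Ht.
move=> k; rewrite !inE => ki; rewrite dotDr dotZr rowd (negbTE ki) oppr0 mulr0 addr0.
exact: (tv k (finset.in_setT _)).2.
Qed.

(** At a vertex the local cone is the orthant spanned by the negated dual
    basis, and its rays carry the edges. *)
Lemma edges_at_vertex (R : realType) n (U : seq 'rV[int]_n) (M : 'M[int]_n)
    (v : 'rV[R]_n) :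
  vertex (hpoly R n U) v -> unimodular_at U M v ->
  edges_at (hpoly R n U) v =
  [set slice R n U M (~: [set i])%SET | i in [set: 'I_n]].
Proof.
move=> Vv Mv; have Pv := vertex_in Vv; have tv := vertex_tight Vv Mv.
have [Mu _] := Mv.
have tJ (J : {set 'I_n}) : tight U M J v by move=> j _; apply: tv; rewrite inE.
apply/seteqP; split=> E.
  move=> [[fE dE] Ev]; have [J [_ EJ dJ]] := face_slice fE Ev Mv.
  have cJ : #|~: J| = 1%N.
    by rewrite cardsCs finset.setCK card_ord; exact: has_dim_uniq dJ dE.
  have /cards1P [i Ji] : #|~: J| == 1%N by rewrite cJ.
  by exists i => //; rewrite EJ -Ji finset.setCK.
move=> [i _ <-]; set J := (~: [set i])%SET; split; last first.
  by split=> // j jJ; have [] := tv j (finset.in_setT _).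
split; last first.
  have := has_dim_slice Mv Pv (tJ J).
  rewrite /J cardsCs finset.setCK card_ord cards1 subKn //.
  exact: leq_trans (ltn_ord i).
(* Each row is at most 1 on the polyhedron, so the sum of the rows other than
   the i-th is maximal exactly on the slice. *)
pose c := \sum_(j in J) intv R (row j M).
have cE j : dot c (intv R (dual_row M j)) = (j \in J)%:R.
  rewrite /c dot_suml; have [jJ|jJ] := boolP (j \in J).
    rewrite (bigD1 j) //= big1 ?addr0; first by rewrite dot_dual_row // eqxx.
    by move=> k /andP [_ kj]; rewrite dot_dual_row // (negbTE kj).
  rewrite big1 // => k kJ; rewrite dot_dual_row //; case: eqP => // kj.
  by rewrite -kj kJ in jJ.
exists c; apply/esym; apply: (argmax_slice Mu Pv (tJ J)) => j; rewrite cE //.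
by rewrite pnatr_eq0 eqb0 negbK.
Qed.

Lemma edge_slice_inj (R : realType) n (U : seq 'rV[int]_n) (M : 'M[int]_n)
    (v : 'rV[R]_n) :
  polytope (hpoly R n U) -> vertex (hpoly R n U) v -> unimodular_at U M v ->
  injective (fun i => slice R n U M (~: [set i])%SET).
Proof.
move=> pP Vv Mv i k /= e; have [Mu _] := Mv.
have tv := vertex_tight Vv Mv.
have [t t0 Ei] := edge_segment i pP (vertex_in Vv) Mv tv.
have : slice R n U M (~: [set i])%SET (v + t *: - intv R (dual_row M i)).
  by rewrite Ei; exists t => //=; rewrite in_itv /= lexx ltW.
rewrite e => -[_ /(_ i)]; rewrite !inE; case: eqP => // _ /(_ isT).
rewrite dotDr (tv i (finset.in_setT _)).2 dotZr dotNr dot_dual_row // eqxx mulrN1.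
by move=> h; exfalso; move: t0 h; clear; lra.
Qed.

Lemma primitive_edge_dir_slice (R : realType) n (U : seq 'rV[int]_n)
    (M : 'M[int]_n) (v : 'rV[R]_n) i (u : 'rV[int]_n) :
  polytope (hpoly R n U) -> vertex (hpoly R n U) v -> unimodular_at U M v ->
  primitive_edge_dir v (slice R n U M (~: [set i])%SET) u <->
  u = - dual_row M i.
Proof.
move=> pP Vv Mv; have [Mu _] := Mv.
have tv := vertex_tight Vv Mv.
have [t t0 Ei] := edge_segment i pP (vertex_in Vv) Mv tv.
have pair : \sum_k (- row i M) 0 k * (- dual_row M i) 0 k = 1.
  transitivity (\sum_k row i M 0 k * dual_row M i 0 k).
    by apply: eq_bigr => k _; rewrite !mxE mulrNN.
  by rewrite dual_row_pairing // eqxx.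
split=> [[pu [t' t'0 Ei']]|->]; last first.
  split; first exact: primitive_vec_pairing pair.
  by exists t => //; rewrite intvN.
have : slice R n U M (~: [set i])%SET (v + t' *: intv R u).
  by rewrite Ei'; exists t' => //=; rewrite in_itv /= lexx ltW.
rewrite Ei => -[s /=]; rewrite in_itv /= => /andP [s0 _] /addrI e.
apply: (primitive_ray_uniq t'0 _ _ pair pu); last by rewrite intvN -e.
rewrite lt_def s0 andbT; apply/eqP => s00; move: e; rewrite s00 scale0r.
move=> /esym /eqP; rewrite scaler_eq0 gt_eqF //= => /eqP u0.
have : v + t' *: intv R u = v by rewrite u0 scaler0 addr0.
have : slice R n U M (~: [set i])%SET (v + t *: - intv R (dual_row M i)).
  by rewrite Ei; exists t => //=; rewrite in_itv /= lexx ltW.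
rewrite Ei' => -[r _]; rewrite u0 scaler0 => /addrI /(congr1 (dot (intv R (row i M)))).
rewrite dot0r dotZr dotNr dot_dual_row // eqxx mulrN1.
by move=> h; exfalso; move: t0 h; clear; lra.
Qed.

(** A face through x is cut out by tight rows and its codimension is their
    number. So a vertex satisfies M v = 1, hence is a lattice point; its edges
    correspond to the rows of M, with primitive directions the negated dual
    basis; and a facet is cut out by a single row, which is a primitive normal
    in U. *)
Theorem admissible_monotone (R : realType) n (U : seq 'rV[int]_n) :
  (0 < n)%N -> admissible R n U -> monotone_polytope (hpoly R n U).
Proof.
move=> n0 [pP loc]; have I0 := hpoly_interior0 R U.
have edge_dir v i M : vertex (hpoly R n U) v -> unimodular_at U M v ->
    primitive_edge_dir v (slice R n U M (~: [set i])%SET) (- dual_row M i).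
  by move=> Vv Mv; apply/(primitive_edge_dir_slice i _ pP Vv Mv).
split; split=> //.
- have P0 : hpoly R n U 0 by move=> u _; rewrite dot0r.
  have [M M0] := loc _ P0.
  have [J [tJ _]] := face_slice (face_self _) P0 M0.
  suff -> : J = finset.set0 by rewrite cards0 subn0.
  apply/eqP/set0Pn => -[j /tJ [_]]; rewrite dot0r => /eqP.
  by rewrite eq_sym oner_eq0.
- move=> v Vv; have [M Mv] := loc _ (vertex_in Vv).
  rewrite (edges_at_vertex Vv Mv); apply/card_eq_seqP.
  exists [seq slice R n U M (~: [set i])%SET | i <- enum 'I_n]; split.
  + by rewrite map_inj_uniq ?enum_uniq //; apply: edge_slice_inj pP Vv Mv.
  + by rewrite size_map size_enum_ord.
  + apply/seteqP; split=> E /=; first by case=> i _ <-; apply/map_f; rewrite mem_enum.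
    by case/mapP=> i _ ->; exists i.
- move=> v E Vv; have [M Mv] := loc _ (vertex_in Vv).
  rewrite (edges_at_vertex Vv Mv) => -[i _ <-].
  by exists (- dual_row M i); apply: edge_dir.
- move=> v Vv; have [M Mv] := loc _ (vertex_in Vv); have [Mu _] := Mv.
  pose B := - (invmx M)^T.
  have rB i : row i B = - dual_row M i by apply/rowP=> k; rewrite !mxE.
  exists B; split.
    apply/seteqP; split=> u.
      move=> [E]; rewrite (edges_at_vertex Vv Mv) => -[i _ <-].
      by move/(primitive_edge_dir_slice i u pP Vv Mv) ->; exists i.
    move=> [i _ <-]; exists (slice R n U M (~: [set i])%SET); last first.
      by rewrite rB; apply: edge_dir.
    by rewrite (edges_at_vertex Vv Mv); exists i.
  have Bu : B \in unitmx.
    by rewrite /B -scaleN1r unitmxZ ?unitrN1 // unitmx_tr unitmx_inv.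
  move=> z; exists (z *m invmx B); split=> [|c].
    by rewrite -mulmx_sum_row mulmxKV.
  by rewrite -mulmx_sum_row => ->; rewrite mulmxK.
- split=> // v Vv; have [M Mv] := loc _ (vertex_in Vv); have [Mu _] := Mv.
  exists (\sum_j dual_row M j) => //.
  rewrite (dual_row_decomp v Mu); transitivity (\sum_j intv R (dual_row M j)).
    by rewrite /intv raddf_sum.
  apply: eq_bigr => j _.
  by rewrite (vertex_tight Vv Mv (finset.in_setT j)).2 scale1r.
- move=> F [fF dF].
  have [x Fx] := has_dim_nonempty dF.
  have Px : hpoly R n U x by case: fF Fx => c -> [].
  have [M Mx] := loc _ Px; have [Mu _] := Mx.
  have [J [tJ FJ dJ]] := face_slice fF Fx Mx.
  have J1 : #|J| == 1%N.
    have Jn : (#|J| <= n)%N by rewrite -[X in (_ <= X)%N]card_ord max_card.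
    by have := has_dim_uniq dJ dF; move: n0 Jn; clear; lia.
  have /cards1P [j Jj] := J1; exists (row j M).
  have /tJ [jU _] : j \in J by rewrite Jj inE.
  split; first exact: primitive_row.
    by move=> y; apply.
  rewrite FJ Jj; apply/seteqP; split=> y [Py h]; split=> //.
    by apply: h; rewrite inE.
  by move=> k; rewrite inE => /eqP ->.
Qed.

(** * Products *)

Definition setprod (R : realType) n m (P : set 'rV[R]_n) (Q : set 'rV[R]_m) :
    set 'rV[R]_(n + m) :=
  [set x | P (lsubmx x) /\ Q (rsubmx x)].

Lemma setprod_row (R : realType) n m (P : set 'rV[R]_n) (Q : set 'rV[R]_m) x y :
  setprod P Q (row_mx x y) <-> P x /\ Q y.
Proof. by rewrite /setprod /= row_mxKl row_mxKr. Qed.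

Lemma setprod_projl (R : realType) n m (P : set 'rV[R]_n) (Q : set 'rV[R]_m) :
  Q !=set0 -> @lsubmx R 1 n m @` setprod P Q = P.
Proof.
move=> [y Qy]; apply/seteqP; split=> x; first by case=> z [Pz _] <-.
by move=> Px; exists (row_mx x y); [apply/setprod_row | rewrite row_mxKl].
Qed.

Lemma setprod_projr (R : realType) n m (P : set 'rV[R]_n) (Q : set 'rV[R]_m) :
  P !=set0 -> @rsubmx R 1 n m @` setprod P Q = Q.
Proof.
move=> [x Px]; apply/seteqP; split=> y; first by case=> z [_ Qz] <-.
by move=> Qy; exists (row_mx x y); [apply/setprod_row | rewrite row_mxKr].
Qed.

Lemma setprod_set1 (R : realType) n m (v : 'rV[R]_(n + m)) :
  [set v] = setprod [set lsubmx v] [set rsubmx v].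
Proof.
apply/seteqP; split=> x; first by move=> ->.
by case=> /= xl xr; rewrite -(hsubmxK x) xl xr hsubmxK.
Qed.

Lemma row_mx_sum (R : realType) n m (I : finType) (w : I -> R)
    (p : I -> 'rV[R]_n) (q : I -> 'rV[R]_m) :
  \sum_i w i *: row_mx (p i) (q i) =
  row_mx (\sum_i w i *: p i) (\sum_i w i *: q i).
Proof.
rewrite -[LHS]hsubmxK !linear_sum; congr row_mx.
  by apply: eq_bigr => i _; rewrite linearZ /= row_mxKl.
by apply: eq_bigr => i _; rewrite linearZ /= row_mxKr.
Qed.

Lemma product_weights (R : realType) (I J : finType) (w : I -> R) (w' : J -> R) :
  \sum_i w i = 1 -> \sum_j w' j = 1 -> \sum_ij w ij.1 * w' ij.2 = 1.
Proof.
move=> w1 w1'; rewrite -(pair_bigA _ (fun i j => w i * w' j)) /= -[RHS]w1.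
by apply: eq_bigr => i _; rewrite -mulr_sumr w1' mulr1.
Qed.

Lemma row_mx_combination (R : realType) n m (I J : finType)
    (w : I -> R) (w' : J -> R) (p : I -> 'rV[R]_n) (q : J -> 'rV[R]_m) :
  \sum_i w i = 1 -> \sum_j w' j = 1 ->
  \sum_ij (w ij.1 * w' ij.2) *: row_mx (p ij.1) (q ij.2) =
  row_mx (\sum_i w i *: p i) (\sum_j w' j *: q j).
Proof.
move=> w1 w1'; rewrite row_mx_sum; congr row_mx.
  rewrite -(pair_bigA _ (fun i j => (w i * w' j) *: p i)) /=.
  by apply: eq_bigr => i _; rewrite -scaler_suml -mulr_sumr w1' mulr1.
rewrite -(pair_bigA _ (fun i j => (w i * w' j) *: q j)) exchange_big /=.
by apply: eq_bigr => j _; rewrite -scaler_suml -mulr_suml w1 mul1r.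
Qed.

Lemma conv_hull_setprod (R : realType) n m (A : set 'rV[R]_n) (B : set 'rV[R]_m) :
  conv_hull (setprod A B) = setprod (conv_hull A) (conv_hull B).
Proof.
apply/seteqP; split=> x.
  case=> k [p [w [Ap w0 w1 ->]]]; split; rewrite linear_sum.
    exists k, (fun i => lsubmx (p i)), w; split=> //; first by move=> i; case: (Ap i).
    by apply: eq_bigr => i _; rewrite linearZ.
  exists k, (fun i => rsubmx (p i)), w; split=> //; first by move=> i; case: (Ap i).
  by apply: eq_bigr => i _; rewrite linearZ.
case=> [[k [p [w [Ap w0 w1 xl]]]] [k' [q [w' [Bq w0' w1' xr]]]]].
rewrite -(hsubmxK x) xl xr -row_mx_combination //.
apply: conv_hull_fin; last exact: product_weights.
  by move=> i; apply/setprod_row.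
by move=> i; rewrite mulr_ge0.
Qed.

Lemma aff_hull_setprod (R : realType) n m (A : set 'rV[R]_n) (B : set 'rV[R]_m) :
  aff_hull (setprod A B) = setprod (aff_hull A) (aff_hull B).
Proof.
apply/seteqP; split=> x.
  case=> k [p [w [Ap w1 ->]]]; split; rewrite linear_sum.
    exists k, (fun i => lsubmx (p i)), w; split=> //; first by move=> i; case: (Ap i).
    by apply: eq_bigr => i _; rewrite linearZ.
  exists k, (fun i => rsubmx (p i)), w; split=> //; first by move=> i; case: (Ap i).
  by apply: eq_bigr => i _; rewrite linearZ.
case=> [[k [p [w [Ap w1 xl]]]] [k' [q [w' [Bq w1' xr]]]]].
rewrite -(hsubmxK x) xl xr -row_mx_combination //.
apply: aff_hull_fin; last exact: product_weights.
by move=> i; apply/setprod_row.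
Qed.

Lemma has_dim_setprod (R : realType) n m (F : set 'rV[R]_n) (G : set 'rV[R]_m) d e :
  has_dim F d -> has_dim G e -> has_dim (setprod F G) (d + e).
Proof.
move=> [x [U [<- FU]]] [y [V [<- GV]]].
pose f : 'Hom('rV[R]_n, 'rV[R]_(n + m)) := linfun (mulmxr (row_mx 1%:M 0)).
pose g : 'Hom('rV[R]_m, 'rV[R]_(n + m)) := linfun (mulmxr (row_mx 0 1%:M)).
have fE u : f u = row_mx u 0 by rewrite lfunE /= mul_mx_row mulmx1 mulmx0.
have gE u : g u = row_mx 0 u by rewrite lfunE /= mul_mx_row mulmx1 mulmx0.
exists (row_mx x y), (f @: U + g @: V)%VS; split.
  rewrite dimv_disjoint_sum; first last.
    apply/eqP; rewrite -subv0; apply/subvP => w; rewrite memv_cap memv0.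
    case/andP=> /memv_imgP [u _ ->] /memv_imgP [v _]; rewrite fE gE.
    by case/eq_row_mx => -> _; rewrite row_mx0.
  congr (_ + _)%N; apply: limg_dim_eq; apply/eqP; rewrite -subv0;
    apply/subvP => w; rewrite memv_cap memv0 memv_ker => /andP [_].
    by rewrite fE -row_mx0 => /eqP /eq_row_mx [-> _].
  by rewrite gE -row_mx0 => /eqP /eq_row_mx [_ ->].
rewrite aff_hull_setprod FU GV; apply/seteqP; split=> z.
  move=> [[u uU xu] [v vV yv]]; exists (f u + g v).
    by apply: memv_add; apply: memv_img.
  by rewrite -(hsubmxK z) -xu -yv fE gE !add_row_mx addr0 add0r.
move=> [_ /memv_addP [_ /memv_imgP [u uU ->] [_ /memv_imgP [v vV ->] ->]] <-].
rewrite fE gE !add_row_mx addr0 add0r; apply/setprod_row.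
by split; [exists u | exists v].
Qed.

(** The affine hulls of the factors are the projections of the affine hull of
    the product, so both factors have a dimension. *)
Lemma has_dim_setprod_inv (R : realType) n m (F : set 'rV[R]_n) (G : set 'rV[R]_m) k :
  has_dim (setprod F G) k ->
  exists d e, [/\ has_dim F d, has_dim G e & k = (d + e)%N].
Proof.
move=> dk; have [z [W [_ FGW]]] := dk.
have [x Fx] := has_dim_nonempty dk.
have hx : setprod (aff_hull F) (aff_hull G) x.
  by rewrite -aff_hull_setprod; exact: sub_aff_hull.
have dF : has_dim F (\dim (linfun (@lsubmx R 1 n m) @: W)).
  exists (lsubmx z), (linfun (@lsubmx R 1 n m) @: W)%VS; split=> //.
  rewrite -(setprod_projl (aff_hull F) (Q := aff_hull G)); last first.
    by exists (rsubmx x); case: hx.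
  rewrite -aff_hull_setprod FGW; apply/seteqP; split=> y.
    move=> [_ [w wW <-] <-]; exists (lsubmx w); last by rewrite linearD.
    by apply/memv_imgP; exists w; rewrite ?lfunE.
  move=> [_ /memv_imgP [w wW ->] <-]; rewrite lfunE /=; exists (z + w).
    by exists w.
  by rewrite linearD.
have dG : has_dim G (\dim (linfun (@rsubmx R 1 n m) @: W)).
  exists (rsubmx z), (linfun (@rsubmx R 1 n m) @: W)%VS; split=> //.
  rewrite -(setprod_projr (P := aff_hull F) (aff_hull G)); last first.
    by exists (lsubmx x); case: hx.
  rewrite -aff_hull_setprod FGW; apply/seteqP; split=> y.
    move=> [_ [w wW <-] <-]; exists (rsubmx w); last by rewrite linearD.
    by apply/memv_imgP; exists w; rewrite ?lfunE.
  move=> [_ /memv_imgP [w wW ->] <-]; rewrite lfunE /=; exists (z + w).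
    by exists w.
  by rewrite linearD.
do 2!eexists; split; [exact: dF | exact: dG |].
exact: has_dim_uniq dk (has_dim_setprod dF dG).
Qed.

Lemma face_setprod (R : realType) n m (P F : set 'rV[R]_n) (Q G : set 'rV[R]_m) :
  face P F -> face Q G -> face (setprod P Q) (setprod F G).
Proof.
move=> [c ->] [c' ->]; exists (row_mx c c'); apply/seteqP; split=> x.
  move=> [[Px mx] [Qx mx']]; split=> // y [Py Qy].
  by rewrite !dot_row_mx lerD ?mx ?mx'.
move=> [[Px Qx] mx]; split; split=> // y Py.
  have := mx (row_mx y (rsubmx x)); rewrite setprod_row => /(_ (conj Py Qx)).
  by rewrite !dot_row_mx row_mxKl row_mxKr lerD2r.
have := mx (row_mx (lsubmx x) y); rewrite setprod_row => /(_ (conj Px Py)).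
by rewrite !dot_row_mx row_mxKl row_mxKr lerD2l.
Qed.

(** A functional on the product is a sum of functionals on the factors, and
    the two summands can be maximized separately. *)
Lemma face_setprod_inv (R : realType) n m (P : set 'rV[R]_n) (Q : set 'rV[R]_m) H :
  face (setprod P Q) H ->
  exists F G, [/\ face P F, face Q G & H = setprod F G].
Proof.
move=> [c ->].
pose F := [set x | P x /\ forall y, P y -> dot (lsubmx c) y <= dot (lsubmx c) x].
pose G := [set x | Q x /\ forall y, Q y -> dot (rsubmx c) y <= dot (rsubmx c) x].
exists F, G; split; [by exists (lsubmx c) | by exists (rsubmx c) |].
apply/seteqP; split=> x; last first.
  by move=> [[Px mx] [Qx mx']]; split=> // y [Py Qy]; rewrite !(dot_lrsub c) lerD ?mx ?mx'.
move=> [[Px Qx] mx]; split; split=> // y Py.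
  have := mx (row_mx y (rsubmx x)); rewrite setprod_row => /(_ (conj Py Qx)).
  by rewrite !(dot_lrsub c) row_mxKl row_mxKr lerD2r.
have := mx (row_mx (lsubmx x) y); rewrite setprod_row => /(_ (conj Px Py)).
by rewrite !(dot_lrsub c) row_mxKl row_mxKr lerD2l.
Qed.

Lemma vertex_setprod (R : realType) n m (P : set 'rV[R]_n) (Q : set 'rV[R]_m) v :
  vertex (setprod P Q) v <-> vertex P (lsubmx v) /\ vertex Q (rsubmx v).
Proof.
rewrite /vertex setprod_set1; split=> [|[]]; last exact: face_setprod.
move=> /face_setprod_inv [F [G [fF fG]]] e.
have [x Fx] : setprod F G !=set0 by exists v; rewrite -e.
rewrite -(setprod_projl [set lsubmx v] (Q := [set rsubmx v])); last by exists (rsubmx v).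
rewrite -{2}(setprod_projr (P := [set lsubmx v]) [set rsubmx v]); last by exists (lsubmx v).
rewrite e setprod_projl ?setprod_projr //.
  by exists (lsubmx x); case: Fx.
by exists (rsubmx x); case: Fx.
Qed.

(** A one-dimensional product of faces is a segment times a point or a point
    times a segment. *)
Lemma edges_at_setprod (R : realType) n m (P : set 'rV[R]_n) (Q : set 'rV[R]_m) v :
  vertex (setprod P Q) v ->
  edges_at (setprod P Q) v =
  [set setprod E [set rsubmx v] | E in edges_at P (lsubmx v)] `|`
  [set setprod [set lsubmx v] E | E in edges_at Q (rsubmx v)].
Proof.
move=> /vertex_setprod [Vl Vr]; apply/seteqP; split=> H.
  move=> [[/face_setprod_inv [F [G [fF fG ->]]] dH] [Fv Gv]].
  have [d [e [dF dG de]]] := has_dim_setprod_inv dH.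
  have sing k (S : set 'rV[R]_k) x : has_dim S 0 -> S x -> S = [set x].
    by move=> /has_dim0 [y ->] /= ->.
  case: d dF de => [|[|d]] dF //= de.
    have e1 : e = 1%N by rewrite add0n in de.
    right; exists G; last by rewrite (sing _ _ _ dF Fv).
    by split=> //; split=> //; rewrite -e1.
  have e0 : e = 0%N by case: de.
  left; exists F; [by split | rewrite e0 in dG; by rewrite (sing _ _ _ dG Gv)].
case=> -[E [[fE dE] Ev] <-].
  split; last by split.
  by split; [exact: face_setprod | exact: has_dim_setprod dE (has_dim_set1 _)].
split; last by split.
by split; [exact: face_setprod | exact: has_dim_setprod (has_dim_set1 _) dE].
Qed.

Lemma simple_setprod (R : realType) n m (P : set 'rV[R]_n) (Q : set 'rV[R]_m) :
  simple_polytope P -> simple_polytope Q -> simple_polytope (setprod P Q).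
Proof.
move=> sP sQ v Vv; have [Vl Vr] := (vertex_setprod _ _ _).1 Vv.
rewrite (edges_at_setprod Vv).
have /card_eq_seqP [s1 [u1 z1 e1]] := sP _ Vl.
have /card_eq_seqP [s2 [u2 z2 e2]] := sQ _ Vr.
apply/card_eq_seqP.
exists ([seq setprod E [set rsubmx v] | E <- s1] ++
        [seq setprod [set lsubmx v] E | E <- s2]); split.
- rewrite cat_uniq; apply/and3P; split.
  + rewrite map_inj_uniq // => E E' /(congr1 (fun H => @lsubmx R 1 n m @` H)).
    by rewrite !setprod_projl //; exists (rsubmx v).
  + apply/hasPn => _ /mapP [E Es2 ->]; apply/mapP => -[E' E's1 e].
    have [[_ dE] Ev] : edges_at Q (rsubmx v) E by rewrite e2.
    have [[_ dE'] E'v] : edges_at P (lsubmx v) E' by rewrite e1.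
    have := congr1 (fun H => @lsubmx R 1 n m @` H) e.
    rewrite !setprod_projl; [|by exists (rsubmx v)|by exists (rsubmx v)].
    by move=> E'1; move: dE'; rewrite -E'1 => /has_dim_uniq /(_ (has_dim_set1 _)).
  + rewrite map_inj_uniq // => E E' /(congr1 (fun H => @rsubmx R 1 n m @` H)).
    by rewrite !setprod_projr //; exists (lsubmx v).
- by rewrite size_cat !size_map z1 z2.
- rewrite e1 e2; apply/seteqP; split=> H /=; rewrite mem_cat.
    case=> -[E Es <-]; apply/orP; [left | right]; exact: map_f.
  by case/orP=> /mapP [E Es ->]; [left | right]; exists E.
Qed.

Lemma primitive_vec_row_mx0 n m (u : 'rV[int]_n) :
  primitive_vec (row_mx u (0 : 'rV[int]_m)) <-> primitive_vec u.
Proof.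
rewrite /primitive_vec big_split_ord /= [X in gcdn _ X]big1 ?gcdn0 => [|i _].
  by under eq_bigr do rewrite row_mxEl.
by rewrite row_mxEr mxE.
Qed.

Lemma primitive_vec_row_0mx n m (u : 'rV[int]_m) :
  primitive_vec (row_mx (0 : 'rV[int]_n) u) <-> primitive_vec u.
Proof.
rewrite /primitive_vec big_split_ord /= [X in gcdn X _]big1 ?gcd0n => [|i _].
  by under eq_bigr do rewrite row_mxEr.
by rewrite row_mxEl mxE.
Qed.

Lemma segment_setprodl (R : realType) n m (v : 'rV[R]_(n + m))
    (u : 'rV[int]_n) (I : set R) :
  [set v + s *: intv R (row_mx u 0) | s in I] =
  setprod [set lsubmx v + s *: intv R u | s in I] [set rsubmx v].
Proof.
have e s : v + s *: intv R (row_mx u 0) =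
    row_mx (lsubmx v + s *: intv R u) (rsubmx v).
  rewrite intv_row_mx scale_row_mx -{1}(hsubmxK v) add_row_mx.
  by rewrite intv0 scaler0 addr0.
apply/seteqP; split=> x.
  by case=> s Is <-; rewrite e; apply/setprod_row; split=> //; exists s.
by case=> -[s Is xl] xr; exists s => //; rewrite e xl -xr hsubmxK.
Qed.

Lemma segment_setprodr (R : realType) n m (v : 'rV[R]_(n + m))
    (u : 'rV[int]_m) (I : set R) :
  [set v + s *: intv R (row_mx 0 u) | s in I] =
  setprod [set lsubmx v] [set rsubmx v + s *: intv R u | s in I].
Proof.
have e s : v + s *: intv R (row_mx 0 u) =
    row_mx (lsubmx v) (rsubmx v + s *: intv R u).
  rewrite intv_row_mx scale_row_mx -{1}(hsubmxK v) add_row_mx.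
  by rewrite intv0 scaler0 addr0.
apply/seteqP; split=> x.
  by case=> s Is <-; rewrite e; apply/setprod_row; split=> //; exists s.
by case=> xl [s Is xr]; exists s => //; rewrite e xr -xl hsubmxK.
Qed.

Lemma primitive_edge_dir_setprodl (R : realType) n m (v : 'rV[R]_(n + m))
    (E : set 'rV[R]_n) u :
  primitive_edge_dir v (setprod E [set rsubmx v]) u <->
  exists2 u', primitive_edge_dir (lsubmx v) E u' & u = row_mx u' 0.
Proof.
split=> [[pu [t t0 e]]|[u' [pu [t t0 ->]] ->]]; last first.
  split; first exact/primitive_vec_row_mx0.
  by exists t => //; rewrite segment_setprodl.
have u0 : rsubmx u = 0.
  have : setprod E [set rsubmx v] (v + t *: intv R u).
    by rewrite e; exists t; rewrite //= in_itv /= lexx ltW.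
  case=> _ /=; rewrite linearD linearZ /= => /eqP.
  rewrite -subr_eq0 addrC addKr scaler_eq0 gt_eqF //= => /eqP h.
  by apply: (@intv_eq0 R); rewrite -h -map_rsubmx.
have ue : u = row_mx (lsubmx u) 0 by rewrite -u0 hsubmxK.
exists (lsubmx u) => //; split.
  by move: pu; rewrite {1}ue => /(primitive_vec_row_mx0 _ _).1.
exists t => //; move: e; rewrite {1}ue segment_setprodl.
move/(congr1 (fun H => @lsubmx R 1 n m @` H)).
by rewrite !setprod_projl //; exists (rsubmx v).
Qed.

Lemma primitive_edge_dir_setprodr (R : realType) n m (v : 'rV[R]_(n + m))
    (E : set 'rV[R]_m) u :
  primitive_edge_dir v (setprod [set lsubmx v] E) u <->
  exists2 u', primitive_edge_dir (rsubmx v) E u' & u = row_mx 0 u'.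
Proof.
split=> [[pu [t t0 e]]|[u' [pu [t t0 ->]] ->]]; last first.
  split; first exact/primitive_vec_row_0mx.
  by exists t => //; rewrite segment_setprodr.
have u0 : lsubmx u = 0.
  have : setprod [set lsubmx v] E (v + t *: intv R u).
    by rewrite e; exists t; rewrite //= in_itv /= lexx ltW.
  case=> + _ /=; rewrite /= linearD linearZ /= => /eqP.
  rewrite -subr_eq0 addrC addKr scaler_eq0 gt_eqF //= => /eqP h.
  by apply: (@intv_eq0 R); rewrite -h -map_lsubmx.
have ue : u = row_mx 0 (rsubmx u) by rewrite -u0 hsubmxK.
exists (rsubmx u) => //; split.
  by move: pu; rewrite {1}ue => /(primitive_vec_row_0mx _ _).1.
exists t => //; move: e; rewrite {1}ue segment_setprodr.
move/(congr1 (fun H => @rsubmx R 1 n m @` H)).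
by rewrite !setprod_projr //; exists (lsubmx v).
Qed.

Lemma int_basis_setprod n m (D : set 'rV[int]_n) (D' : set 'rV[int]_m) :
  int_basis D -> int_basis D' ->
  int_basis ([set row_mx u 0 | u in D] `|` [set row_mx 0 u | u in D']).
Proof.
move=> [B [-> uB]] [B' [-> uB']]; exists (block_mx B 0 0 B').
have rl i : row (lshift m i) (block_mx B 0 0 B') = row_mx (row i B) 0.
  by rewrite rowKu row_row_mx row0.
have rr i : row (rshift n i) (block_mx B 0 0 B') = row_mx 0 (row i B').
  by rewrite rowKd row_row_mx row0.
split.
  apply/seteqP; split=> u.
    case=> [[_ [i _ <-] <-]|[_ [i _ <-] <-]].
      by exists (lshift m i).
    by exists (rshift n i).
  move=> [i _ <-]; case: (split_ordP i) => j ->.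
    by left; exists (row j B); [exists j | rewrite rl].
  by right; exists (row j B'); [exists j | rewrite rr].
move=> z; have [c [zc cu]] := uB (lsubmx z); have [c' [zc' cu']] := uB' (rsubmx z).
exists (row_mx c c'); rewrite -mulmx_sum_row in zc; rewrite -mulmx_sum_row in zc'.
split=> [|d].
  by rewrite -mulmx_sum_row mul_row_block !mulmx0 addr0 add0r -zc -zc' hsubmxK.
rewrite -mulmx_sum_row -{1}(hsubmxK d) mul_row_block !mulmx0 addr0 add0r => ze.
rewrite -[RHS]hsubmxK (cu (lsubmx d)) ?(cu' (rsubmx d)) //.
  by rewrite -mulmx_sum_row ze row_mxKr.
by rewrite -mulmx_sum_row ze row_mxKl.
Qed.

Lemma smooth_setprod (R : realType) n m (P : set 'rV[R]_n) (Q : set 'rV[R]_m) :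
  smooth_polytope P -> smooth_polytope Q -> smooth_polytope (setprod P Q).
Proof.
move=> [[A [fA PA]] dP sP rP bP] [[B [fB QB]] dQ sQ rQ bQ]; split.
- exists (setprod A B); split; last by rewrite conv_hull_setprod PA QB.
  suff -> : setprod A B = [set row_mx x.1 x.2 | x in A `*` B].
    by apply/finite_image/finite_setX.
  apply/seteqP; split=> x; last by case=> -[a b] [/= Aa Bb] <-; apply/setprod_row.
  by case=> Al Br; exists (lsubmx x, rsubmx x); rewrite //= hsubmxK.
- exact: has_dim_setprod.
- exact: simple_setprod.
- move=> v H Vv; have [Vl Vr] := (vertex_setprod _ _ _).1 Vv.
  rewrite (edges_at_setprod Vv) => -[] [E Ev <-].
    have [u pu] := rP _ _ Vl Ev; exists (row_mx u 0).
    by apply/primitive_edge_dir_setprodl; exists u.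
  have [u pu] := rQ _ _ Vr Ev; exists (row_mx 0 u).
  by apply/primitive_edge_dir_setprodr; exists u.
- move=> v Vv; have [Vl Vr] := (vertex_setprod _ _ _).1 Vv.
  rewrite (edges_at_setprod Vv).
  have := int_basis_setprod (bP _ Vl) (bQ _ Vr); congr int_basis.
  apply/seteqP; split=> u.
    case=> -[w [E Ew pw] <-].
      exists (setprod E [set rsubmx v]); first by left; exists E.
      by apply/primitive_edge_dir_setprodl; exists w.
    exists (setprod [set lsubmx v] E); first by right; exists E.
    by apply/primitive_edge_dir_setprodr; exists w.
  move=> [_ [[E Ew <-]|[E Ew <-]]].
    by move=> /primitive_edge_dir_setprodl [w pw ->]; left; exists w => //; exists E.
  by move=> /primitive_edge_dir_setprodr [w pw ->]; right; exists w => //; exists E.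
Qed.

Lemma int_lattice_row_mx (R : realType) n m (x : 'rV[R]_n) (y : 'rV[R]_m) :
  int_lattice (row_mx x y) <-> int_lattice x /\ int_lattice y.
Proof.
split=> [[z _ e]|[[z _ <-] [z' _ <-]]]; last first.
  by exists (row_mx z z'); rewrite ?intv_row_mx.
move: e; rewrite -(hsubmxK z) intv_row_mx => /eq_row_mx [<- <-].
by split; [exists (lsubmx z) | exists (rsubmx z)].
Qed.

Lemma ball_row (R : realType) n m (e : R) (x : 'rV[R]_(n + m)) :
  ball 0 e x -> ball 0 e (lsubmx x) /\ ball 0 e (rsubmx x).
Proof.
move=> [e0 xe]; split; split=> // i j.
  by have := xe i (lshift m j); rewrite !mxE.
by have := xe i (rshift n j); rewrite !mxE.
Qed.

(** A face of codimension one in the product has codimension one in one factor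
    and is everything in the other, so its normal is that of a facet of the
    first factor, extended by 0. *)
Lemma reflexive_setprod (R : realType) n m (P : set 'rV[R]_n) (Q : set 'rV[R]_m) :
  (0 < n)%N -> (0 < m)%N -> has_dim P n -> has_dim Q m ->
  polytope (setprod P Q) ->
  reflexive_polytope P -> reflexive_polytope Q ->
  reflexive_polytope (setprod P Q).
Proof.
move=> n0 m0 dP dQ pPQ [[_ lP] iP fP] [[_ lQ] iQ fQ]; split.
- split=> // v /vertex_setprod [Vl Vr]; rewrite -(hsubmxK v).
  by apply/int_lattice_row_mx; split; [exact: lP | exact: lQ].
- have /nbhs_ballP [e /= e0 Pe] := iP; have /nbhs_ballP [e' /= e0' Qe'] := iQ.
  apply/nbhs_ballP; exists (Num.min e e'); first by rewrite /= lt_min e0.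
  move=> x /ball_row [xl xr]; split.
    by apply: Pe; apply: le_ball xl; rewrite ge_min lexx.
  by apply: Qe'; apply: le_ball xr; rewrite ge_min lexx orbT.
- move=> H [/face_setprod_inv [F [G [fF fG ->]]] dH].
  have [d [e [dF dG de]]] := has_dim_setprod_inv dH.
  have dn := has_dim_le dF; have em := has_dim_le dG.
  have [[ed ee]|[ed ee]] : (d = n /\ e = m.-1) \/ (d = n.-1 /\ e = m).
    by move: dn em de n0 m0; clear; lia.
    rewrite ed in dF; rewrite ee in dG.
    have FP := has_dim_full_face fF dF.
    have [|u [pu uQ Gu]] := fQ G; first by split.
    exists (row_mx 0 u); split; first exact/primitive_vec_row_0mx.
      move=> x [_ Qx]; rewrite intv_row_mx dot_row_mx.
      by rewrite intv0 dot0l add0r uQ.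
    rewrite FP Gu; apply/seteqP; split=> x; rewrite intv_row_mx /= dot_row_mx;
      rewrite intv0 dot0l add0r.
      by case=> ? [].
    by case=> -[].
  rewrite ed in dF; rewrite ee in dG.
  have GQ := has_dim_full_face fG dG.
  have [|u [pu uP Fu]] := fP F; first by split.
  exists (row_mx u 0); split; first exact/primitive_vec_row_mx0.
    move=> x [Px _]; rewrite intv_row_mx dot_row_mx.
    by rewrite intv0 dot0l addr0 uP.
  rewrite GQ Fu; apply/seteqP; split=> x; rewrite intv_row_mx /= dot_row_mx;
    rewrite intv0 dot0l addr0.
    by case=> -[].
  by case=> -[].
Qed.

Theorem monotone_setprod (R : realType) n m (P : set 'rV[R]_n) (Q : set 'rV[R]_m) :
  (0 < n)%N -> (0 < m)%N ->
  monotone_polytope P -> monotone_polytope Q -> monotone_polytope (setprod P Q).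
Proof.
move=> n0 m0 [sP rP] [sQ rQ]; have sPQ := smooth_setprod sP sQ.
split=> //; case: sP sQ sPQ => [_ dP _ _ _] [_ dQ _ _ _] [pPQ _ _ _ _].
exact: reflexive_setprod.
Qed.

Lemma Ewald_set_setprod (R : realType) n m (P : set 'rV[R]_n) (Q : set 'rV[R]_m) :
  Ewald_set (setprod P Q) = setprod (Ewald_set P) (Ewald_set Q).
Proof.
have memN k (S : set 'rV[R]_k) x : [set - y | y in S] x <-> S (- x).
  by split=> [[y Sy <-]|Sx]; [rewrite opprK | exists (- x); rewrite ?opprK].
apply/seteqP; split=> x; rewrite /Ewald_set /=.
  move=> [[]]; rewrite -{1}(hsubmxK x) => /int_lattice_row_mx [xl xr] [Pl Pr].
  by move=> /memN []; rewrite !linearN /= => Nl Nr; split; split=> //; apply/memN.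
move=> [[[xl Pl] /memN Nl] [[xr Pr] /memN Nr]]; split; last first.
  by apply/memN; split; rewrite linearN.
by split=> //; rewrite -(hsubmxK x); apply/int_lattice_row_mx.
Qed.

Lemma card_setprod (R : realType) n m (A : set 'rV[R]_n) (B : set 'rV[R]_m) a b :
  A #= `I_a -> B #= `I_b -> setprod A B #= `I_(a * b).
Proof.
move=> /card_eq_seqP [s [us <- ->]] /card_eq_seqP [s' [us' <- ->]].
apply/card_eq_seqP; exists [seq row_mx x y | x <- s, y <- s']; split.
- by apply: allpairs_uniq => // -[x y] [x' y'] _ _ /= /eq_row_mx [-> ->].
- by rewrite size_allpairs.
apply/seteqP; split=> x /=.
  by case=> xl xr; rewrite -(hsubmxK x); apply: allpairs_f.
by case/allpairsP=> -[y z] [/= ys zs ->]; apply/setprod_row.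
Qed.

Lemma Ewald_counts_mul (R : realType) n m a b : (0 < n)%N -> (0 < m)%N ->
  Ewald_counts R n a -> Ewald_counts R m b -> Ewald_counts R (n + m) (a * b).
Proof.
move=> n0 m0 [P [mP cP]] [Q [mQ cQ]]; exists (setprod P Q).
by split; [exact: monotone_setprod | rewrite Ewald_set_setprod; exact: card_setprod].
Qed.

(** * Simplex bundles *)

(** Facet normals of the bundle over the polyhedron of U whose fibre over b is
    the simplex x_i >= -1, sum x_i <= 1 + l.b. *)
Definition bundle_normals n d (U : seq 'rV[int]_n) (l : 'rV[int]_n) :
    seq 'rV[int]_(n + d) :=
  [seq row_mx u 0 | u <- U] ++
  [seq row_mx 0 (- delta_mx 0 i) | i <- enum 'I_d] ++
  [:: row_mx (- l) (const_mx 1)].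
Arguments bundle_normals {n} d U l.

Lemma dot_delta (R : realType) n (i : 'I_n) (x : 'rV[R]_n) :
  dot (intv R (delta_mx 0 i)) x = x 0 i.
Proof.
rewrite /dot (bigD1 i) //= big1 ?addr0; first by rewrite !mxE !eqxx mul1r.
by move=> j ji; rewrite !mxE (negbTE ji) andbF mul0r.
Qed.

Lemma dot_const1 (R : realType) n (x : 'rV[R]_n) :
  dot (intv R (const_mx 1)) x = \sum_i x 0 i.
Proof. by apply: eq_bigr => i _; rewrite !mxE mul1r. Qed.

Lemma dot_facet (R : realType) n d (x : 'rV[R]_(n + d)) (i : 'I_d) :
  dot (intv R (row_mx 0 (- delta_mx 0 i))) x = - rsubmx x 0 i.
Proof. by rewrite intv_row_mx dot_row_mx intv0 dot0l add0r intvN dotNl dot_delta. Qed.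

Lemma dot_roof (R : realType) n d (l : 'rV[int]_n) (x : 'rV[R]_(n + d)) :
  dot (intv R (row_mx (- l) (const_mx 1))) x =
  \sum_i rsubmx x 0 i - dot (intv R l) (lsubmx x).
Proof. by rewrite intv_row_mx dot_row_mx intvN dotNl dot_const1 addrC. Qed.

Lemma dot_base (R : realType) n d (u : 'rV[int]_n) (x : 'rV[R]_(n + d)) :
  dot (intv R (row_mx u 0)) x = dot (intv R u) (lsubmx x).
Proof. by rewrite intv_row_mx dot_row_mx intv0 dot0l addr0. Qed.

Lemma hpoly_bundle (R : realType) n d (U : seq 'rV[int]_n) l (x : 'rV[R]_(n + d)) :
  hpoly R (n + d) (bundle_normals d U l) x <->
  [/\ hpoly R n U (lsubmx x), forall i, -1 <= rsubmx x 0 i &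
      \sum_i rsubmx x 0 i <= 1 + dot (intv R l) (lsubmx x)].
Proof.
split=> [h|[hU h1 hl] u].
  split.
  - move=> u uU; rewrite -dot_base; apply: h; rewrite mem_cat; apply/orP; left.
    exact: (map_f (fun u => row_mx u 0)).
  - move=> i; rewrite lerNl -dot_facet; apply: h.
    rewrite !mem_cat; apply/or3P; constructor 2.
    by apply: (map_f (fun i => row_mx 0 (- delta_mx 0 i))); rewrite mem_enum.
  - by rewrite -lerBlDr -dot_roof; apply: h; rewrite !mem_cat mem_head !orbT.
rewrite !mem_cat => /or3P [/mapP [v vU ->]|/mapP [i _ ->]|].
- by rewrite dot_base; exact: hU.
- by rewrite dot_facet lerNl.
by rewrite inE => /eqP ->; rewrite dot_roof lerBlDr.
Qed.

Lemma hpoly_convex (R : realType) n (U : seq 'rV[int]_n) (A : set 'rV[R]_n) :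
  A `<=` hpoly R n U -> conv_hull A `<=` hpoly R n U.
Proof.
move=> AU x [m [p [w [Ap w0 w1 ->]]]] u uU.
rewrite dot_sumr -w1; apply: ler_sum => i _; rewrite dotZr.
by rewrite -[leRHS]mulr1 ler_wpM2l //; apply: AU.
Qed.

(** The vertices of the simplex over a base point move affinely with that
    point, so the simplex vertices over a finite generating set of the base
    generate the bundle. *)
Lemma polytope_bundle (R : realType) n d (U : seq 'rV[int]_n) (l : 'rV[int]_n) :
  polytope (hpoly R n U) ->
  (forall b, hpoly R n U b -> - d%:R <= dot (intv R l) b) ->
  polytope (hpoly R (n + d) (bundle_normals d U l)).
Proof.
move=> [A [fA UA]] hl.
(* h is the edge length of the fibre, and [apex b] lists the d + 1 vertices of
   the fibre over b, with None for the corner (-1, ..., -1). *)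
pose h (b : 'rV[R]_n) : R := d%:R + 1 + dot (intv R l) b.
have h_gt0 b : hpoly R n U b -> 0 < h b by move=> /hl; rewrite /h; lra.
pose apex (b : 'rV[R]_n) (o : option 'I_d) : 'rV[R]_d :=
  const_mx (-1) + (if o is Some i then h b *: delta_mx 0 i else 0).
have apexE b o i : apex b o 0 i = -1 + h b * (o == Some i)%:R.
  rewrite !mxE; case: o => [j|]; last by rewrite mxE mulr0.
  by rewrite !mxE eqxx /= eq_sym.
have AU a : A a -> hpoly R n U a by rewrite UA; exact: sub_conv_hull.
exists [set row_mx ao.1 (apex ao.1 ao.2) | ao in A `*` [set: option 'I_d]].
split; first by apply/finite_image/finite_setX => //; exact: finite_finset.
apply/seteqP; split; last first.
  apply: hpoly_convex => _ [[a o] [/= /AU Ua _] <-]; apply/hpoly_bundle.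
  rewrite row_mxKl row_mxKr; split=> // [i|].
    by rewrite apexE lerDl mulr_ge0 ?ler0n // ltW // h_gt0.
  under eq_bigr do rewrite apexE.
  rewrite big_split /= sumr_const card_ord -mulr_sumr.
  have : \sum_(i < d) (o == Some i)%:R <= 1 :> R.
    case: o => [j|]; last by rewrite big1.
    rewrite (bigD1 j) //= eqxx big1 ?addr0 // => i ij.
    by rewrite (inj_eq Some_inj) eq_sym (negbTE ij).
  move=> /(ler_wpM2l (ltW (h_gt0 _ Ua))); rewrite mulr1 /h.
  by rewrite -mulr_natr; lra.
move=> x /hpoly_bundle [Ub x1 xl]; set b := lsubmx x in Ub xl *.
have [k [p [w [Ap w0 w1 bE]]]] : conv_hull A b by rewrite -UA.
have hb := h_gt0 b Ub.
(* the barycentric coordinates of x in the fibre *)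
pose mu (o : option 'I_d) : R := if o is Some i then (rsubmx x 0 i + 1) / h b
  else 1 - \sum_i (rsubmx x 0 i + 1) / h b.
have mu0 o : 0 <= mu o.
  case: o => [i|] /=; first by rewrite divr_ge0 ?(ltW hb) // -lerBlDr sub0r.
  rewrite subr_ge0 -mulr_suml ler_pdivrMr // mul1r big_split /= sumr_const card_ord.
  by rewrite /h; move: xl; lra.
have mu1 : \sum_o mu o = 1 by rewrite big_option /= subrK.
have yE : rsubmx x = \sum_o mu o *: apex b o.
  apply/rowP => i; rewrite summxE.
  under eq_bigr do rewrite mxE apexE mulrDr.
  rewrite big_split /= -mulr_suml mu1 mul1r (bigD1 (Some i)) //= big1 => [|o oi].
    by rewrite eqxx mulr1 addr0 divfK ?gt_eqF // addrC addrK.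
  by rewrite (negbTE oi) !mulr0.
have apex_b o : apex b o = \sum_j w j *: apex (p j) o.
  apply/rowP => i; rewrite summxE apexE.
  under eq_bigr do rewrite mxE apexE mulrDr mulrA.
  rewrite big_split /= -mulr_suml w1 mul1r -mulr_suml; congr (_ + _ * _).
  rewrite /h; under eq_bigr do rewrite mulrDr.
  rewrite big_split /= -mulr_suml w1 mul1r bE dot_sumr.
  by congr (_ + _); apply: eq_bigr => j _; rewrite dotZr.
have -> : x = \sum_jo (w jo.1 * mu jo.2) *: row_mx (p jo.1) (apex (p jo.1) jo.2).
  rewrite row_mx_sum -[LHS]hsubmxK -/b; congr row_mx.
    rewrite -(pair_bigA _ (fun j o => (w j * mu o) *: p j)) /= bE.
    by apply: eq_bigr => j _; rewrite -scaler_suml -mulr_sumr mu1 mulr1.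
  rewrite -(pair_bigA _ (fun j o => (w j * mu o) *: apex (p j) o)) exchange_big /= yE.
  apply: eq_bigr => o _; rewrite apex_b scaler_sumr.
  by apply: eq_bigr => j _; rewrite scalerA mulrC.
apply: conv_hull_fin; last exact: product_weights.
  by move=> [j o] /=; exists (p j, o) => //; split=> //; exact: Ap.
by move=> i; rewrite mulr_ge0.
Qed.

(** The matrix with rows -e_i, except for one row of ones, is an involution. *)
Lemma simplex_corner_unit d (i0 : 'I_d) :
  (\matrix_(i, j) (if i == i0 then 1 else - (i == j)%:R) : 'M[int]_d) \in unitmx.
Proof.
set N := (X in X \in _); suff /mulmx1_unit [] : N *m N = 1%:M by [].
apply/matrixP => i j; rewrite !mxE.
have [->|ii0] := eqVneq i i0.
  under eq_bigr do rewrite !mxE eqxx mul1r.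
  rewrite (bigD1 i0) //= eqxx.
  have [<-|ji0] := eqVneq i0 j.
    by rewrite big1 ?addr0 // => k /negbTE ki; rewrite ki.
  rewrite (bigD1 j) /=; last by rewrite eq_sym.
  rewrite (eq_sym j) (negbTE ji0) eqxx big1 ?addr0 ?subrr //.
  by move=> k /andP [/negbTE -> /negbTE ->]; rewrite oppr0.
rewrite (bigD1 i) //= !mxE (negbTE ii0) eqxx mulN1r opprK big1 ?addr0 //.
by move=> k ki; rewrite !mxE (negbTE ii0) eq_sym (negbTE ki) oppr0 mul0r.
Qed.

(** The simplex over a base point has positive edge length, so one of its
    d + 1 inequalities is slack, and the normals of the d others complete M to
    a block triangular unimodular matrix. *)
Lemma unimodular_bundle (R : realType) n d (U : seq 'rV[int]_n) (l : 'rV[int]_n)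
    (x : 'rV[R]_(n + d)) :
  - d%:R <= dot (intv R l) (lsubmx x) ->
  (exists M, unimodular_at U M (lsubmx x)) ->
  exists M, unimodular_at (bundle_normals d U l) M x.
Proof.
move=> hl [M [Mu act]].
have [[i0 xi0]|all1] := pselect (exists i0, rsubmx x 0 i0 != -1).
  pose N : 'M[int]_d := \matrix_(i, j) (if i == i0 then 1 else - (i == j)%:R).
  pose L : 'M[int]_(d, n) := \matrix_(i, j) (if i == i0 then - l 0 j else 0).
  exists (block_mx M 0 L N); split.
    rewrite unitmxE det_lblock unitrM -!unitmxE Mu /=; exact: simplex_corner_unit.
  move=> u; rewrite !mem_cat => /or3P [/mapP [v vU ->]|/mapP [i _ ->]|].
  - rewrite dot_base => /(act _ vU) [i ->]; exists (lshift d i).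
    by rewrite rowKu row_row_mx row0.
  - rewrite dot_facet => /eqP; rewrite eqr_oppLR => /eqP xi.
    have ii0 : i != i0 by apply: contraNneq xi0 => <-; rewrite xi.
    exists (rshift n i); rewrite rowKd row_row_mx; congr row_mx; apply/rowP=> j.
      by rewrite !mxE (negbTE ii0).
    by rewrite !mxE (negbTE ii0) eqxx /= eq_sym.
  - rewrite inE => /eqP -> _; exists (rshift n i0); rewrite rowKd row_row_mx.
    by congr row_mx; apply/rowP=> j; rewrite !mxE eqxx.
exists (block_mx M 0 0 (- 1%:M)); split.
  rewrite unitmxE det_lblock unitrM -!unitmxE Mu /=.
  by rewrite -scaleN1r unitmxZ ?unitrN1 // unitmx1.
move=> u; rewrite !mem_cat => /or3P [/mapP [v vU ->]|/mapP [i _ ->]|].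
- rewrite dot_base => /(act _ vU) [i ->]; exists (lshift d i).
  by rewrite rowKu row_row_mx row0.
- move=> _; exists (rshift n i); rewrite rowKd row_row_mx row0; congr row_mx.
  by apply/rowP=> j; rewrite !mxE eqxx /= eq_sym.
rewrite inE => /eqP ->; rewrite dot_roof => e; exfalso.
have : \sum_i rsubmx x 0 i = - d%:R.
  transitivity (\sum_(i < d) (-1 : R)); last by rewrite sumr_const card_ord mulNrn.
  apply: eq_bigr => i _; apply/eqP; apply: contra_notT all1 => xi; by exists i.
by move: e hl; lra.
Qed.

Lemma admissible_bundle (R : realType) n d (U : seq 'rV[int]_n) (l : 'rV[int]_n) :
  admissible R n U ->
  (forall b, hpoly R n U b -> - d%:R <= dot (intv R l) b) ->
  admissible R (n + d) (bundle_normals d U l).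
Proof.
move=> [pU locU] hl; split; first exact: polytope_bundle.
move=> x /hpoly_bundle [Ub _ _]; apply: unimodular_bundle; first exact: hl.
exact: locU.
Qed.

(** * Counting Ewald points along a tower *)

Definition pairing n (u z : 'rV[int]_n) : int := \sum_k u 0 k * z 0 k.

Definition ewald_point n (U : seq 'rV[int]_n) (z : 'rV[int]_n) : bool :=
  all (fun u => `|pairing u z| <= 1) U.

Lemma ewald_pointP (R : realType) n (U : seq 'rV[int]_n) (z : 'rV[int]_n) :
  ewald_point U z <-> hpoly R n U (intv R z) /\ hpoly R n U (- intv R z).
Proof.
have e (u : 'rV[int]_n) : (`|pairing u z| <= 1) =
    (dot (intv R u) (intv R z) <= 1) && (dot (intv R u) (- intv R z) <= 1).
  by rewrite dotNr dot_intv -mulrNz !(ler_int R _ 1) ler_norml lerNl andbC.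
split=> [/allP h|[h1 h2]].
  by split=> u /h; rewrite e => /andP [].
by apply/allP => u uU; rewrite e h1 ?h2.
Qed.

Lemma card_Ewald_set (R : realType) n (U : seq 'rV[int]_n) (s : seq 'rV[int]_n) :
  uniq s -> (forall z, (z \in s) = ewald_point U z) ->
  Ewald_set (hpoly R n U) #= `I_(size s).
Proof.
move=> us sE; apply/card_eq_seqP; exists [seq intv R z | z <- s]; split.
- by rewrite map_inj_uniq //; exact: intv_inj.
- by rewrite size_map.
apply/seteqP; split=> x.
  move=> [[[z _ <-] Pz] [y Py yz]]; apply: map_f; rewrite sE.
  by apply/(ewald_pointP R); split=> //; rewrite -yz opprK.
move=> /mapP [z]; rewrite sE => /(ewald_pointP R) [Pz Nz] ->.
by split; [split=> //; exists z | exists (- intv R z); rewrite ?opprK].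
Qed.

(** Fibre points are listed as words of integers, which evaluate, before being
    turned into row vectors: the counts for d = 1, 2, 3 are then obtained by
    computation. *)
Fixpoint sign_words d : seq (seq int) :=
  if d is d'.+1 then [seq a :: w | a <- [:: -1; 0; 1], w <- sign_words d']
  else [:: [::]].

Definition word_sum (w : seq int) : int := foldr +%R 0 w.

Definition fibre_words d (t : int) : seq (seq int) :=
  [seq w <- sign_words d | `|word_sum w - t| <= 1].

Definition row_of_word d (w : seq int) : 'rV[int]_d := \row_i w`_i.

Lemma mem_sign_words d w :
  (w \in sign_words d) = (size w == d) && all (fun a => `|a| <= 1) w.
Proof.
elim: d w => [|d IH] w; first by case: w.
have unit_ball (a : int) : (a \in [:: -1; 0; 1]) = (`|a| <= 1).
  by rewrite !inE; apply/idP/idP; lia.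
apply/allpairsP/idP => [[[a v] [/= ha hv ->]]|].
  by move: hv; rewrite IH /= eqSS -unit_ball ha => /andP [-> ->].
case: w => // a w /= /andP [sw /andP [ha hw]].
by exists (a, w); split; rewrite //= ?unit_ball // IH hw andbT.
Qed.

Lemma sign_words_uniq d : uniq (sign_words d).
Proof.
elim: d => //= d IH; apply: (allpairs_uniq (s := [:: -1; 0; 1])) => //.
by move=> [a w] [b v] _ _ /= [-> ->].
Qed.

Definition fibre d (t : int) : seq 'rV[int]_d :=
  [seq row_of_word d w | w <- fibre_words d t].

Lemma fibre_uniq d t : uniq (fibre d t).
Proof.
rewrite map_inj_in_uniq ?filter_uniq ?sign_words_uniq // => w v.
rewrite !mem_filter !mem_sign_words => /and3P [_ /eqP sw _] /and3P [_ /eqP sv _].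
move=> /rowP e; apply: (@eq_from_nth _ 0) => [|i]; first by rewrite sw sv.
by rewrite sw => id; have := e (Ordinal id); rewrite !mxE.
Qed.

Lemma word_sumE d (x : 'rV[int]_d) :
  word_sum [seq x 0 i | i <- enum 'I_d] = \sum_i x 0 i.
Proof. by rewrite /word_sum foldrE big_map big_enum. Qed.

Lemma mem_fibre d t (x : 'rV[int]_d) :
  (x \in fibre d t) =
  [forall i, `|x 0 i| <= 1] && (`|\sum_i x 0 i - t| <= 1).
Proof.
have wordK (y : 'rV[int]_d) : row_of_word d [seq y 0 i | i <- enum 'I_d] = y.
  apply/rowP => i; rewrite mxE (nth_map i) ?size_enum_ord //.
  by rewrite nth_ord_enum.
apply/mapP/andP.
  case=> w; rewrite mem_filter mem_sign_words => /and3P [hs /eqP sw /allP hw] ->.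
  split; first by apply/forallP => i; rewrite mxE hw // mem_nth // sw.
  move: hs; rewrite -(word_sumE (row_of_word d w)); congr (`| word_sum _ - _ | <= _).
  apply: (@eq_from_nth _ 0) => [|i]; rewrite sw ?size_map -?enumT ?size_enum_ord // => id.
  by rewrite (nth_map (Ordinal id)) ?size_enum_ord // mxE nth_enum_ord.
move=> [/forallP h1 hs]; exists [seq x 0 i | i <- enum 'I_d]; last by rewrite wordK.
rewrite mem_filter word_sumE hs mem_sign_words size_map size_enum_ord eqxx /=.
by apply/allP => _ /mapP [i _ ->].
Qed.

Lemma pairing_base n d (u : 'rV[int]_n) (b : 'rV[int]_n) (x : 'rV[int]_d) :
  pairing (row_mx u 0) (row_mx b x) = pairing u b.
Proof.
rewrite /pairing big_split_ord /= [X in _ + X]big1 ?addr0.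
  by apply: eq_bigr => i _; rewrite !row_mxEl.
by move=> i _; rewrite row_mxEr mxE mul0r.
Qed.

Lemma pairing_delta d (x : 'rV[int]_d) i : pairing (delta_mx 0 i) x = x 0 i.
Proof.
rewrite /pairing (bigD1 i) //= big1 ?addr0; first by rewrite !mxE !eqxx mul1r.
by move=> j ji; rewrite !mxE (negbTE ji) andbF mul0r.
Qed.

Lemma pairing_facet n d (b : 'rV[int]_n) (x v : 'rV[int]_d) :
  pairing (row_mx 0 v) (row_mx b x) = pairing v x.
Proof.
rewrite /pairing big_split_ord /= [X in X + _]big1 ?add0r.
  by apply: eq_bigr => i _; rewrite !row_mxEr.
by move=> i _; rewrite row_mxEl mxE mul0r.
Qed.

Lemma pairingNl n (u z : 'rV[int]_n) : pairing (- u) z = - pairing u z.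
Proof. by rewrite /pairing -sumrN; apply: eq_bigr => i _; rewrite mxE mulNr. Qed.

Lemma pairingZl n a (u z : 'rV[int]_n) : pairing (a *: u) z = a * pairing u z.
Proof. by rewrite /pairing mulr_sumr; apply: eq_bigr => i _; rewrite mxE mulrA. Qed.

Lemma pairing_roof n d (l b : 'rV[int]_n) (x : 'rV[int]_d) :
  pairing (row_mx (- l) (const_mx 1)) (row_mx b x) = \sum_i x 0 i - pairing l b.
Proof.
rewrite {1}/pairing big_split_ord /= addrC -pairingNl; congr (_ + _).
  by apply: eq_bigr => i _; rewrite !row_mxEr mxE mul1r.
by apply: eq_bigr => i _; rewrite !row_mxEl.
Qed.

Lemma ewald_point_bundle n d (U : seq 'rV[int]_n) l b (x : 'rV[int]_d) :
  ewald_point (bundle_normals d U l) (row_mx b x) =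
  ewald_point U b && (x \in fibre d (pairing l b)).
Proof.
rewrite /ewald_point mem_fibre !all_cat /= andbT pairing_roof !all_map.
congr [&& _, _ & _]; first by apply: eq_all => u /=; rewrite pairing_base.
apply/allP/forallP => h i.
  have := h i; rewrite -enumT mem_enum /= => /(_ isT).
  by rewrite pairing_facet pairingNl normrN pairing_delta.
by move=> _ /=; rewrite pairing_facet pairingNl normrN pairing_delta.
Qed.

Definition bundle_points n d (l : 'rV[int]_n) (s : seq 'rV[int]_n) :
    seq 'rV[int]_(n + d) :=
  [seq row_mx b x | b <- s, x <- fibre d (pairing l b)].

Lemma mem_bundle_points n d (U : seq 'rV[int]_n) l s z :
  (forall b, (b \in s) = ewald_point U b) ->
  (z \in bundle_points d l s) = ewald_point (bundle_normals d U l) z.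
Proof.
move=> sE; rewrite -(hsubmxK z) ewald_point_bundle -sE.
apply/allpairsPdep/andP => [[b [x [bs xf /eq_row_mx [-> ->]]]] //|[bs xf]].
by exists (lsubmx z), (rsubmx z).
Qed.

Lemma bundle_points_uniq n d (l : 'rV[int]_n) s :
  uniq s -> uniq (bundle_points d l s).
Proof.
move=> us; apply: allpairs_uniq_dep => // [b _|]; first exact: fibre_uniq.
by move=> [b x] [c y] _ _ /= /eq_row_mx [-> ->].
Qed.

Lemma count_bundle_points n d (l : 'rV[int]_n) s (p : pred 'rV[int]_d) :
  count (p \o rsubmx) (bundle_points d l s) =
  sumn [seq count p (fibre d (pairing l b)) | b <- s].
Proof.
rewrite /bundle_points count_flatten -map_comp; congr sumn.
apply: eq_map => b /=; rewrite count_map; apply: eq_count => x /=.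
by rewrite row_mxKr.
Qed.

Lemma sumn_dichotomy (T : eqType) (s : seq T) (p : pred T) (f : T -> nat) A C :
  (forall b, b \in s -> f b = if p b then A else C) ->
  sumn [seq f b | b <- s] = (A * count p s + C * count (predC p) s)%N.
Proof.
elim: s => [|b s IH] h; first by rewrite /= !muln0.
rewrite /= IH => [|c cs]; last by rewrite h // inE cs orbT.
by rewrite h ?mem_head //; case: (p b) => /=; lia.
Qed.

(** The bound z >= -1 does two things: d * z is then large enough for a bundle
    of d-simplices, and z takes only the values 0, 1 and -1 at Ewald points.
    The Ewald points are counted separately for z = 0 and z != 0 because the
    next fibre over them depends only on this distinction, up to x -> -x. *)
Definition tower (R : realType) n (e0 e1 : nat) : Prop :=
  exists (U s : seq 'rV[int]_n) (z : 'rV[int]_n),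
    [/\ admissible R n U, forall b, hpoly R n U b -> -1 <= dot (intv R z) b,
        uniq s /\ (forall b, (b \in s) = ewald_point U b),
        count (fun b => pairing z b == 0) s = e0 &
        count (fun b => pairing z b != 0) s = e1].
Arguments tower : clear implicits.

Lemma tower_point (R : realType) : tower R 0 1 0.
Proof.
have x0 k (x : 'rV[k]_0) y : x = y by apply/rowP; case.
exists [::], [:: 0], 0; split=> //.
- split=> [|x _]; last by exists 1%:M; split; rewrite ?unitmx1.
  exists [set 0]; split; first exact: finite_set1.
  by apply/seteqP; split=> // x _; rewrite (x0 _ x 0); apply: sub_conv_hull.
- by move=> b _; rewrite (x0 _ b 0) dot0r lerN10.
- by split=> // b; rewrite (x0 _ b 0) mem_head.
- by rewrite /= /pairing big_ord0.
- by rewrite /= /pairing big_ord0.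
Qed.

Lemma count_fibre d (p : pred int) t :
  count (fun x : 'rV[int]_d.+1 => p (x 0 0)) (fibre d.+1 t) =
  count (fun w => p (head 0 w)) (fibre_words d.+1 t).
Proof. by rewrite count_map; apply: eq_count => w /=; rewrite mxE nth0. Qed.

(** The functional used for the bundle is d.+1 * z, and the first fibre
    coordinate becomes the new functional. The columns (A0, A1) and (C0, C1) of
    the transition matrix are the fibre counts over z = 0 and over z = 1, -1. *)
Lemma tower_step (R : realType) n d e0 e1 A0 A1 C0 C1 :
  let n0 t := count (fun w => head 0 w == 0) (fibre_words d.+1 t) in
  let n1 t := count (fun w => head 0 w != 0) (fibre_words d.+1 t) in
  n0 0 = A0 -> n1 0 = A1 ->
  n0 d.+1%:Z = C0 -> n1 d.+1%:Z = C1 ->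
  n0 (- d.+1%:Z) = C0 -> n1 (- d.+1%:Z) = C1 ->
  tower R n e0 e1 ->
  tower R (n + d.+1) (A0 * e0 + C0 * e1) (A1 * e0 + C1 * e1).
Proof.
move=> n0 n1; rewrite /n0 /n1 -!(count_fibre _ (fun a => a == 0)).
rewrite -!(count_fibre _ (fun a => a != 0)) => hA0 hA1 hC0 hC1 hC0' hC1'.
move=> [U [s [z [aU hz [us sE] <- <-]]]].
pose l := d.+1%:Z *: z.
have dotl b : dot (intv R l) b = d.+1%:R * dot (intv R z) b.
  by rewrite /l intvZ dotZl.
have hl b : hpoly R n U b -> - d.+1%:R <= dot (intv R l) b.
  by move=> /hz zb; rewrite dotl -mulrN1 ler_wpM2l.
have newz b x : pairing (row_mx 0 (delta_mx 0 0))
    (row_mx b x : 'rV[int]_(n + d.+1)) = x 0 0.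
  by rewrite pairing_facet pairing_delta.
have zs b : b \in s -> [\/ pairing z b = 0, pairing z b = 1 | pairing z b = -1].
  rewrite sE => /(ewald_pointP R) [/hz + /hz]; rewrite dotNr dot_intv -/(pairing z b).
  rewrite -mulrNz !(ler_int R (-1)) => h1 h2.
  have : pairing z b = 0 \/ pairing z b = 1 \/ pairing z b = -1 by lia.
  by case=> [|[|]] ->; [constructor 1 | constructor 2 | constructor 3].
have cnt (p : pred 'rV[int]_d.+1) A C : count p (fibre d.+1 0) = A ->
    count p (fibre d.+1 d.+1%:Z) = C -> count p (fibre d.+1 (- d.+1%:Z)) = C ->
    count (p \o rsubmx) (bundle_points d.+1 l s) =
    (A * count (fun b => pairing z b == 0) s +
     C * count (fun b => pairing z b != 0) s)%N.
  move=> hA hC hC'; rewrite count_bundle_points.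
  apply: (@sumn_dichotomy _ s (fun b => pairing z b == 0)) => b /zs.
  by rewrite pairingZl; case=> ->; rewrite ?mulr0 ?mulr1 ?mulrN1.
exists (bundle_normals d.+1 U l), (bundle_points d.+1 l s), (row_mx 0 (delta_mx 0 0)).
split.
- exact: admissible_bundle.
- move=> b /hpoly_bundle [_ h _].
  by rewrite intv_row_mx dot_row_mx intv0 dot0l add0r dot_delta.
- split; first exact: bundle_points_uniq.
  by move=> b; exact: mem_bundle_points.
- rewrite -(cnt _ A0 C0 hA0 hC0 hC0'); apply: eq_count => x /=.
  by rewrite -{1}(hsubmxK x) newz.
- rewrite -(cnt _ A1 C1 hA1 hC1 hC1'); apply: eq_count => x /=.
  by rewrite -{1}(hsubmxK x) newz.
Qed.

Lemma tower_segment (R : realType) : tower R 1 1 2.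
Proof.
apply: (@tower_step R 0 0 1 0 1 2 1 1) => //; exact: tower_point.
Qed.

(** Over z = 0 there are 7 pairs in {-1, 0, 1}^2 of sum at most 1 in absolute
    value, and over z = 1 there are 3 pairs of sum at least 1. *)
Lemma tower_triangle (R : realType) n e0 e1 : tower R n e0 e1 ->
  tower R (n + 2) (3 * e0 + e1) (4 * e0 + 2 * e1).
Proof.
by have := @tower_step R n 1 e0 e1 3 4 1 2; rewrite mul1n; apply.
Qed.

(** Over z = 0 there are 19 triples in {-1, 0, 1}^3 of sum at most 1 in absolute
    value, and over z = 1 only 4 triples of sum at least 2. *)
Lemma tower_tetrahedron (R : realType) n e0 e1 : tower R n e0 e1 ->
  tower R (n + 3) (7 * e0 + e1) (12 * e0 + 3 * e1).
Proof.
by have := @tower_step R n 2 e0 e1 7 12 1 3; rewrite mul1n; apply.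
Qed.

Lemma tower_Ewald_counts (R : realType) n e0 e1 : (0 < n)%N ->
  tower R n e0 e1 -> Ewald_counts R n (e0 + e1).
Proof.
move=> n0 [U [s [z [aU _ [us sE] <- <-]]]]; exists (hpoly R n U); split.
  exact: admissible_monotone.
by have := card_Ewald_set R us sE; rewrite -(count_predC (fun b => pairing z b == 0)).
Qed.

(** The vector (1, 2) is an eigenvector of the tetrahedron step, with
    eigenvalue 9. *)
Lemma tower_tetrahedra (R : realType) k : tower R (3 * k + 1) (9 ^ k) (2 * 9 ^ k).
Proof.
elim: k => [|k /tower_tetrahedron IH]; first exact: tower_segment.
move: IH; congr tower; rewrite ?expnS; lia.
Qed.

(** * The minimum and its growth *)

(** Fekete's lemma. If m nearly realizes the infimum l of a n / n, then
    n = q m + r gives a n <= q a m + a r, so a n / n is at most a m / m plus an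
    error of order 1 / n. *)
Lemma fekete (R : realType) (a : nat -> R) :
  (forall n, (0 < n)%N -> 0 <= a n) ->
  (forall m n, (0 < m)%N -> (0 < n)%N -> a (m + n)%N <= a m + a n) ->
  exists2 l, (n%:R^-1 * a n) @[n --> \oo] --> l &
    forall n, (0 < n)%N -> l <= n%:R^-1 * a n.
Proof.
move=> a0 asub; pose S := [set n%:R^-1 * a n | n in [set n | (0 < n)%N]].
have S0 : has_lbound S.
  by exists 0 => _ [n /= n0 <-]; rewrite mulr_ge0 ?invr_ge0 ?ler0n ?a0.
have iS : has_inf S by split=> //; exists (1%:R^-1 * a 1%N), 1%N.
have le_inf n : (0 < n)%N -> inf S <= n%:R^-1 * a n.
  by move=> n0; apply: ge_inf => //; exists n.
exists (inf S) => //; apply/cvgrPdist_le => e e0.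
have e20 : 0 < e / 2 by rewrite divr_gt0.
have [_ [m /= m0 <-] mS] := inf_adherent e20 iS.
have am q r : (0 < r)%N -> a (q * m + r)%N <= q%:R * a m + a r.
  elim: q => [|q IH] r0; first by rewrite mul0n add0n mul0r add0r.
  rewrite mulSn -addnA; apply: le_trans (asub _ _ m0 _) _; first by rewrite ltn_addl.
  by rewrite -natr1 mulrDl mul1r addrAC [leRHS]addrC lerD2l IH.
pose C := \sum_(r < m.+1) `|a r|.
have aC r : (r <= m)%N -> a r <= C.
  move=> rm; rewrite /C (bigD1 (Ordinal (rm : (r < m.+1)%N))) //=.
  by apply: le_trans (ler_norm _) _; rewrite lerDl sumr_ge0.
have C0 : 0 <= C by apply: sumr_ge0.
have [N CN] : exists N : nat, C / (e / 2) <= N%:R.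
  by exists (Num.bound (C / (e / 2))); apply/ltW/archi_boundP/divr_ge0 => //; exact: ltW.
exists N.+1 => // n /= Nn; have n0 : (0 < n)%N by apply: leq_ltn_trans Nn.
have nR : 0 < n%:R :> R by rewrite ltr0n.
rewrite distrC ger0_norm ?subr_ge0 ?le_inf //.
(* Dividing n.-1 makes the remainder r range over [1, m], so that it is never
   0, where subadditivity is not assumed. *)
pose q := (n.-1 %/ m)%N; pose r := (n.-1 %% m).+1.
have nE : n = (q * m + r)%N by rewrite addnS -divn_eq prednK.
have rm : (r <= m)%N by rewrite ltn_mod.
have h1 : a n <= q%:R * a m + C.
  by rewrite {1}nE; apply: le_trans (am _ _ _) _ => //; rewrite lerD2l aC.
have h2 : q%:R * a m <= n%:R * (m%:R^-1 * a m).
  rewrite mulrA ler_wpM2r ?a0 // ler_pdivlMr ?ltr0n // -natrM ler_nat.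
  by rewrite {1}nE leq_addr.
have h3 : C <= n%:R * (e / 2).
  rewrite -ler_pdivrMr //; apply: le_trans CN _.
  by rewrite ler_nat ltnW // ltnW.
have h4 : n%:R * (m%:R^-1 * a m) <= n%:R * (inf S + e / 2).
  by rewrite ler_pM2l // ltW.
rewrite lerBlDr mulrC ler_pdivrMr //.
by apply: le_trans h1 _; move: h2 h3 h4; rewrite !mulrDl !mulrDr; lra.
Qed.

Lemma is_minimum_exists (A : set nat) : A !=set0 -> exists m, is_minimum A m.
Proof.
move=> [n An]; have exA : exists n, `[< A n >] by exists n; apply/asboolP.
have [m /asboolP Am mmin] := ex_minnP exA.
by exists m; split=> // k Ak; apply: mmin; apply/asboolP.
Qed.

(** The cubes [-1, 1]^n are monotone, with 3^n Ewald points. *)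
Lemma Ewald_counts_nonempty (R : realType) n : (0 < n)%N -> Ewald_counts R n !=set0.
Proof.
have c1 : Ewald_counts R 1 3.
  by apply: (@tower_Ewald_counts R 1 1 2) => //; exact: tower_segment.
elim: n => // -[|n] IH _; first by exists 3%N.
have [//|m cm] := IH; exists (3 * m)%N.
exact: (@Ewald_counts_mul R 1 n.+1 3 m isT isT c1 cm).
Qed.

Lemma Emin_minimum (R : realType) n : (0 < n)%N ->
  is_minimum (Ewald_counts R n) (Emin R n).
Proof.
by move=> /(Ewald_counts_nonempty R)/is_minimum_exists; exact: xgetPex.
Qed.

Lemma Emin_le (R : realType) n m : (0 < n)%N ->
  Ewald_counts R n m -> (Emin R n <= m)%N.
Proof. by move=> /(Emin_minimum R) [_]; apply. Qed.

(** The origin is always an Ewald point. *)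
Lemma Emin_gt0 (R : realType) n : (0 < n)%N -> (0 < Emin R n)%N.
Proof.
move=> /(Emin_minimum R) [[P [[_ [_ P0 _]] cP]] _]; rewrite lt0n.
apply/eqP => E0; move: cP; rewrite E0 II0 card_eq0 => /eqP/seteqP [/(_ 0) h _].
have Pz : P 0 by exact: interior_subset P0.
apply: h; split; last by exists 0; rewrite ?oppr0.
by split=> //; exists 0 => //; exact: intv0.
Qed.

Lemma Emin_mul (R : realType) m n : (0 < m)%N -> (0 < n)%N ->
  (Emin R (m + n) <= Emin R m * Emin R n)%N.
Proof.
move=> m0 n0; apply: Emin_le; first by rewrite addn_gt0 m0.
have [cm _] := Emin_minimum R m0; have [cn _] := Emin_minimum R n0.
exact: Ewald_counts_mul m0 n0 cm cn.
Qed.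

Lemma Emin_tower_le (R : realType) n e0 e1 : (0 < n)%N ->
  tower R n e0 e1 -> (Emin R n <= e0 + e1)%N.
Proof. by move=> n0 /(tower_Ewald_counts n0); exact: Emin_le. Qed.

Lemma Emin_3k1 (R : realType) k : (Emin R (3 * k + 1) <= 3 * 9 ^ k)%N.
Proof.
rewrite [(3 * 9 ^ k)%N]mulSn; apply: Emin_tower_le (tower_tetrahedra R k).
by rewrite addn1.
Qed.

Lemma Emin_3k3 (R : realType) k : (Emin R (3 * k + 3) <= 13 * 9 ^ k)%N.
Proof.
have -> : (3 * k + 3 = 3 * k + 1 + 2)%N by lia.
have := Emin_tower_le _ (tower_triangle (tower_tetrahedra R k)).
by rewrite addn_gt0 orbT => /(_ isT) h; apply: leq_trans h _; lia.
Qed.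

Lemma Emin_3k5 (R : realType) k : (Emin R (3 * k.+1 + 2) <= 59 * 9 ^ k)%N.
Proof.
have -> : (3 * k.+1 + 2 = 3 * k + 1 + 2 + 2)%N by lia.
have := Emin_tower_le _ (tower_triangle (tower_triangle (tower_tetrahedra R k))).
by rewrite addn_gt0 orbT => /(_ isT) h; apply: leq_trans h _; lia.
Qed.

Lemma cube_root_9 (R : realType) : (9%:R `^ (3%:R^-1)) ^+ 3 = 9%:R :> R.
Proof. by rewrite -powR_mulrn ?powR_ge0 // -powRrM mulVf // powRr1. Qed.

Lemma cube_root_9_approx (R : realType) :
  `|9%:R `^ (3%:R^-1) - 208%:R / 100%:R| < 5%:R / 1000%:R :> R.
Proof.
have := cube_root_9 R; have := powR_ge0 (9%:R : R) 3%:R^-1.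
move: (9%:R `^ _) => x x0 x3; rewrite ltr_distl; apply/andP; split.
  rewrite ltNge; apply/negP => h.
  have : x ^+ 3 <= (208%:R / 100%:R - 5%:R / 1000%:R) ^+ 3.
    by apply: lerXn2r; rewrite // nnegrE; lra.
  by rewrite x3; lra.
rewrite ltNge; apply/negP => h.
have : (208%:R / 100%:R + 5%:R / 1000%:R) ^+ 3 <= x ^+ 3.
  by apply: lerXn2r; rewrite // nnegrE; lra.
by rewrite x3; lra.
Qed.

(** The limit is the exponential of the Fekete limit l of ln Emin. The bound in
    dimension 3k + 1 reads (3k + 1) l <= ln 3 + k ln 9, which for large k forces
    3 l <= ln 9. *)
Lemma Emin_limit (R : realType) : exists l : R,
  ((Emin R n)%:R `^ (n%:R^-1) : R) @[n --> \oo] --> l /\ l <= 9%:R `^ (3%:R^-1).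
Proof.
pose a n : R := ln (Emin R n)%:R.
have Epos n : (0 < n)%N -> 0 < (Emin R n)%:R :> R by move=> n0; rewrite ltr0n Emin_gt0.
have [|m n m0 n0|l al l_le] := @fekete R a.
- by move=> n n0; rewrite ln_ge0 // ler1n Emin_gt0.
- rewrite -lnM ?posrE ?Epos // ler_ln ?posrE ?mulr_gt0 ?Epos ?addn_gt0 ?m0 //.
  by rewrite -natrM ler_nat Emin_mul.
exists (expR l); split.
  rewrite (_ : (fun n => _) = expR \o (fun n => n%:R^-1 * a n)).
    by apply: continuous_cvg => //; exact: continuous_expR.
  apply/funext => -[|n] /=; first by rewrite invr0 mul0r powRr0 expR0.
  by rewrite /powR gt_eqF ?Epos.
rewrite /powR gt_eqF ?ltr0n // ler_expR.
have ln9 : ln (9%:R : R) = 2 * ln 3%:R.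
  by rewrite -[9%N]/(3 * 3)%N natrM lnM ?posrE ?ltr0n // mulrDl mul1r.
have bound k : (3 * k%:R + 1) * l <= ln 3%:R + k%:R * ln 9%:R.
  have n0 : (0 < 3 * k + 1)%N by rewrite addn1.
  have := l_le _ n0; rewrite mulrC ler_pdivlMr ?ltr0n // natrD natrM mulrC => /le_trans; apply.
  rewrite -[k%:R * _]mulrC mulr_natr -lnXn ?ltr0n // -lnM ?posrE ?exprn_gt0 ?ltr0n //.
  rewrite ler_ln ?posrE ?Epos ?mulr_gt0 ?exprn_gt0 ?ltr0n //.
  by rewrite -natrX -natrM ler_nat Emin_3k1.
suff : 3 * l - ln 9%:R <= 0 by lra.
rewrite leNgt; apply/negP => h.
have /archi_boundP : 0 <= `|ln (3%:R : R) - l| / (3 * l - ln 9%:R).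
  by apply: divr_ge0 => //; exact: ltW.
rewrite ltr_pdivrMr //; have := ler_norm (ln (3%:R : R) - l).
by move: (Num.bound _) => N; have := bound N; rewrite mulrDl mulrBr; lra.
Qed.

Theorem theorem2p8 (R : realType) :
  (* the minimum defining Emin is attained for every n >= 1 *)
  (forall n : nat, (1 <= n)%N -> is_minimum (Ewald_counts R n) (Emin R n)) /\
  (forall k : nat,
    [/\ (Emin R (3 * k + 1))%:R <= 3%:R * 9%:R ^+ k :> R,
        k <> 0%N ->
          (Emin R (3 * k + 2))%:R <= 59%:R / 9%:R * 9%:R ^+ k :> R &
        (Emin R (3 * k + 3))%:R <= 13%:R * 9%:R ^+ k :> R]) /\
  (exists l : R,
    ((Emin R n)%:R `^ (n%:R^-1) : R) @[n --> \oo] --> l /\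
    l <= 9%:R `^ (3%:R^-1)) /\
  (* the decimal approximation 2.08 of the cube root of 9 *)
  `|9%:R `^ (3%:R^-1) - 208%:R / 100%:R| < 5%:R / 1000%:R :> R.
Proof.
split; first exact: Emin_minimum.
split; last by split; [exact: Emin_limit | exact: cube_root_9_approx].
move=> k; split=> [|k0|].
- by rewrite -natrX -natrM ler_nat Emin_3k1.
- case: k k0 => // k _; rewrite exprS mulrA divfK ?pnatr_eq0 //.
  by rewrite -natrX -natrM ler_nat Emin_3k5.
- by rewrite -natrX -natrM ler_nat Emin_3k3.
Qed.
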